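(* Suppose that $s$ and $k$ are natural numbers with $k\ge 2$ and $s\ge k(k+1)$. Then for each $\varepsilon>0$, one has $$J_{s,k}(X)\ll X^{2s-\frac{1}{2}k(k+1)+\varepsilon},$$ where the implicit constant depends at most on $s$, $k$ and $\varepsilon$.
   Context: Write $e(z)=e^{2\pi i z}$. For $\boldsymbol\alpha\in\mathbb{R}^k$ put $f_k(\boldsymbol\alpha;X)=\sum_{1\le x\le X}e(\alpha_1x+\ldots+\alpha_kx^k)$ and $J_{s,k}(X)=\int_{[0,1)^k}|f_k(\boldsymbol\alpha;X)|^{2s}\,d\boldsymbol\alpha$. Equivalently, $J_{s,k}(X)$ is the number of integral solutions of the system $x_1^j+\ldots+x_s^j=y_1^j+\ldots+y_s^j$ $(1\le j\le k)$ with $1\le x_i,y_i\le X$ $(1\le i\le s)$. Here $X\ge 1$ is a real number. *)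

(* Defs.v *)
From mathcomp Require Import all_boot all_order all_algebra.
From mathcomp Require Import all_classical all_reals all_analysis.
From mathcomp Require Import complex.

Set Implicit Arguments.
Unset Strict Implicit.
Unset Printing Implicit Defensive.

Import Order.TTheory GRing.Theory Num.Theory.

Local Open Scope ring_scope.

(* e(z) = exp(2 pi i z); only real arguments occur in what follows. *)
Definition e (R : realType) (z : R) : R[i] :=
  (cos (2 * pi * z) +i* sin (2 * pi * z))%C.

(* The components alpha_1, ..., alpha_k are indexed from 0: alpha_(j+1) is
   tnth alpha j. The range 1 <= x <= truncn X is 1 <= x <= X, as truncn X is
   the integer part of X when X >= 0, and is 0 when X < 0. *)
Definition weyl_sum (R : realType) (k : nat) (alpha : k.-tuple R) (X : R) :
    R[i] :=
  \sum_(1 <= x < (Num.truncn X).+1)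
    e (\sum_(j < k) tnth alpha j * x%:R ^+ j.+1).

(* Lebesgue integral over [0,1)^k as an iterated integral; by Tonelli this
   is the integral against k-dimensional Lebesgue measure whenever F is
   nonnegative and Borel measurable. *)
Fixpoint unit_cube_integral (R : realType) (k : nat) :
    (k.-tuple R -> \bar R) -> \bar R :=
  match k with
  | 0 => fun F => F [tuple]
  | k'.+1 => fun F =>
      (\int[lebesgue_measure]_(a in `[0%R, 1%R[%classic)
         unit_cube_integral (fun t : k'.-tuple R => F [tuple of a :: t]))%E
  end.

Definition vinogradov_mean_value (R : realType) (s k : nat) (X : R) : \bar R :=
  unit_cube_integral (fun alpha : k.-tuple R =>
    ((ComplexField.Normc.normc (weyl_sum alpha X)) ^+ (2 * s))%:E).

(* Main.v *)
Require Import Defs.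
From mathcomp Require Import all_boot all_order all_algebra.
From mathcomp Require Import all_classical all_reals all_analysis.
From mathcomp Require Import measurable_realfun complex zify ring lra.

(* Efficient congruencing (Wooley), with a fixed prime p and X = p^B. Write
   f_b(c) for the part of the Weyl sum over x = c mod p^b. Integrals of |f|^(2m)
   count solutions of systems, and are replaced by averages over a finite group
   (Z/M)^k with M large, where Hoelder's inequality and orthogonality are
   elementary. It suffices to treat s = k(k+1); let J_B be the count for X = p^B
   and let I(a,b) be the mean value of
     |prod_(i<k) f_(a+1)(c_i)|^2 |f_b(d)|^(2k^2)
   with c_1, ..., c_k in the same class modulo p^a but distinct modulo p^(a+1).
   Either f_b(d) is essentially a single f_(b+1)(d'), or it is dominated by a
   product of k distinct classes modulo p^(b+1). In the second case the power
   sums of the first k variables about d are prescribed modulo p^(jb) in degree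
   j, so that these variables fall into few classes modulo p^(kb), and Hoelder's
   inequality gives a bound by I(b,kb)^(1/k) J_(B-b-1)^(1-1/k).
   Suppose that J_(B') <= A p^(B'(theta)) for B' < B, where theta exceeds the
   conjectural exponent by eta > 0. The factor J_(B-b-1)^(1-1/k) then gains
   p^(-eta(1-1/k)b) over the bound on I(b,kb). After n iterations the bound on
   I(a,b) has improved by p^(-n eta(1-1/k)b), up to a constant power of p not
   depending on n. For n large this beats all losses and yields J_B. *)

Set Implicit Arguments.
Unset Strict Implicit.
Unset Printing Implicit Defensive.

Import Order.TTheory GRing.Theory Num.Theory numFieldNormedType.Exports.

Local Open Scope ring_scope.

(** * Power sums modulo prime powers *)

Lemma eqmodn_sum (I : finType) (F G : I -> nat) (d : nat) :
  (forall i, F i = G i %[mod d]) ->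
  (\sum_i F i = \sum_i G i %[mod d])%N.
Proof.
move=> FG; rewrite -modn_summ -[RHS]modn_summ.
by congr (_ %% _)%N; apply: eq_bigr => i _.
Qed.

Lemma eqmodnX (m n d j : nat) :
  (m = n %[mod d] -> m ^ j = n ^ j %[mod d])%N.
Proof. by move=> mn; rewrite -modnXm mn modnXm. Qed.

(** The last digit in base [u] and the quotient together determine the residue modulo [v]. In the
    count of lifts these quotients serve as keys. *)
Lemma eqmodn_divmod (u v m n : nat) : (u %| v)%N ->
  m = n %[mod u] -> ((m %% v) %/ u = (n %% v) %/ u)%N -> m = n %[mod v].
Proof.
move=> uv mn dmn; rewrite (divn_eq (m %% v) u) (divn_eq (n %% v) u) dmn.
by rewrite !modn_dvdm // mn.
Qed.

Definition psum (I : finType) (j : nat) (x : I -> nat) : nat :=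
  (\sum_i x i ^ j)%N.

Lemma psum0 (I : finType) (x : I -> nat) : psum 0 x = #|I|.
Proof. by rewrite /psum sum1_card. Qed.

Lemma eqmodn_psum (I : finType) (j d : nat) (x y : I -> nat) :
  (forall i, x i = y i %[mod d]) -> psum j x = psum j y %[mod d].
Proof. by move=> xy; apply: eqmodn_sum => i; apply: eqmodnX. Qed.

Lemma psumM (I : finType) (j c : nat) (x : I -> nat) :
  psum j (fun i => c * x i)%N = (c ^ j * psum j x)%N.
Proof. by rewrite /psum big_distrr; apply: eq_bigr => i _; rewrite expnMn. Qed.

Lemma psumD (I : finType) (j c : nat) (x : I -> nat) :
  psum j (fun i => x i + c)%N =
  (\sum_(m < j.+1) 'C(j, m) * c ^ m * psum (j - m) x)%N.
Proof.
rewrite /psum; under eq_bigr do rewrite expnDn.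
rewrite exchange_big /=; apply: eq_bigr => m _.
by rewrite big_distrr /=; apply: eq_bigr => i _; rewrite mulnAC mulnA.
Qed.

Lemma eqmodn_psumD (I : finType) (k d c : nat) (x y : I -> nat) :
  (forall j, (j <= k)%N -> psum j x = psum j y %[mod d]) ->
  forall j, (j <= k)%N ->
    psum j (fun i => x i + c)%N = psum j (fun i => y i + c)%N %[mod d].
Proof.
move=> xy j jk; rewrite !psumD; apply: eqmodn_sum => m.
rewrite -modnMmr xy ?modnMmr //.
by rewrite (leq_trans (leq_subr _ _)).
Qed.

(** Invertibility of a Vandermonde matrix: pair the relations with the polynomial [q] of degree
    below [k] that vanishes at every [x l] except [x i]. *)
Lemma sum_powers_eq0 (F : fieldType) (k : nat) (x d : 'I_k -> F) :
  injective x -> (forall j, (j < k)%N -> \sum_i d i * x i ^+ j = 0) ->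
  forall i, d i = 0.
Proof.
move=> xI dx i.
pose q := \prod_(l <- enum (predC1 i)) ('X - (x l)%:P).
have sq : (size q <= k)%N.
  by rewrite size_prod_XsubC -cardE cardC1 card_ord (ltn_predK (ltn_ord i)).
have : \sum_l d l * q.[x l] = 0.
  under eq_bigr => l _ do rewrite (horner_coef_wide _ sq) big_distrr /=.
  rewrite exchange_big big1 //= => j _.
  under eq_bigr => l _ do rewrite mulrCA.
  by rewrite -big_distrr /= dx ?mulr0.
rewrite (bigD1 i) //= [X in _ + X]big1 ?addr0 => [|l li]; last first.
  rewrite /q big_enum horner_prod (bigD1 l) //= hornerXsubC subrr mul0r mulr0 //.
move=> /eqP; rewrite mulf_eq0 => /orP[/eqP //|].
rewrite /q big_enum horner_prod => /negPn/negP; case; apply/prodf_neq0 => l li.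
by rewrite hornerXsubC subr_eq0; apply: contra li => /eqP/xI ->.
Qed.

Lemma eqmodn_intr (p m n : nat) : prime p ->
  (m = n %[mod p]) <-> (m%:R = n%:R :> 'F_p).
Proof.
move=> pp; split=> [mn|/(congr1 val)].
  by apply/val_inj; rewrite /= !val_Fp_nat // mn.
by rewrite /= !val_Fp_nat.
Qed.

Lemma dvdz_Fp (p : nat) (z : int) : prime p ->
  ((p%:Z %| z)%Z) = (z%:~R == 0 :> 'F_p).
Proof.
move=> pp.
have H (n : nat) : ((p%:Z %| n%:Z)%Z) = (n%:R == 0 :> 'F_p).
  rewrite /dvdz /= /dvdn; apply/eqP/eqP => [h|].
    by apply/(@eqmodn_intr p n 0 pp); rewrite h mod0n.
  by move=> /(@eqmodn_intr p n 0 pp); rewrite mod0n.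
case: z => n; first by rewrite H.
by rewrite NegzE dvdzE abszN -dvdzE H rmorphN oppr_eq0.
Qed.

Lemma eqmodn_dvdz (d m n : nat) :
  (m = n %[mod d]) <-> (d%:Z %| n%:Z - m%:Z)%Z.
Proof.
rewrite -eqz_mod_dvd; split => [mn|/eqP]; last by rewrite !modz_nat => -[].
by apply/eqP; rewrite !modz_nat mn.
Qed.

(* Hensel's lemma for power sums: the Jacobian is a Vandermonde matrix, which
   is invertible modulo p. *)
Lemma psum_hensel (p k n : nat) (x y : 'I_k -> nat) :
  prime p -> (k < p)%N -> (forall i j, x i = x j %[mod p] -> i = j) ->
  (forall i, x i = y i %[mod p]) ->
  (forall j, (j <= k)%N -> psum j x = psum j y %[mod p ^ n]) ->
  forall i, x i = y i %[mod p ^ n].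
Proof.
move=> pp kp xI xy xyn.
suff H m : (m <= n)%N -> forall i, x i = y i %[mod p ^ m] by apply: H.
elim: m => [|[|m] IHm] mn i; first by rewrite !expn0 !modn1.
  by rewrite expn1; apply: xy.
move: i; have {}IHm i := (eqmodn_dvdz (p ^ m.+1) (x i) (y i)).1 (IHm (ltnW mn) i).
(* To lift the congruence by one power of p, it suffices that the next digits [d i] of the
   differences vanish modulo p. *)
have /fin_all_exists[d dE] i : exists d : int,
    (y i)%:Z - (x i)%:Z = d * (p ^ m.+1)%:Z by apply/dvdzP.
suff d0 i : ((d i)%:~R : 'F_p) = 0.
  move=> i; apply/eqmodn_dvdz; rewrite dE [in X in (X %| _)%Z]expnS PoszM.
  by apply: dvdz_mul; rewrite ?dvdzz // dvdz_Fp // d0.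
have xI' : injective (fun i => (x i)%:R : 'F_p).
  by move=> i1 i2 /(eqmodn_intr _ _ pp); apply: xI.
apply: (sum_powers_eq0 xI' (d := fun i => (d i)%:~R)) => j jk.
have jp : ((j.+1)%:R : 'F_p) != 0.
  apply/eqP => /(@eqmodn_intr p j.+1 0 pp).
  by rewrite mod0n modn_small // (leq_ltn_trans jk).
have := xyn j.+1 jk => /(f_equal (fun z => z %% p ^ m.+2)%N).
rewrite !modn_dvdm ?dvdn_exp2l // => /eqmodn_dvdz.
rewrite /psum -[Posz (\sum_i y i ^ _)]natz -[Posz (\sum_i x i ^ _)]natz.
rewrite !natr_sum -sumrB.
(* After factoring y^(j+1) - x^(j+1), one power p^(m+1) cancels. Modulo p there remains (j+1) times
   the sum of d_i x_i^j, because x and y agree modulo p; and j+1 <= k < p is invertible. *)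
under eq_bigr => m' _ do rewrite !natrX !natz subrXX dE mulrAC.
rewrite -big_distrl /= [in X in (X %| _)%Z]expnS PoszM.
rewrite dvdz_mul2r; last first.
  by rewrite eqz_nat expn_eq0 negb_and -lt0n prime_gt0.
rewrite dvdz_Fp // rmorph_sum /= => /eqP E.
apply: (mulfI jp); rewrite mulr0 -[RHS]E big_distrr /=; apply: eq_bigr => h _.
rewrite rmorphM mulrCA; congr (_ * _).
rewrite rmorph_sum /=.
under eq_bigr => l _.
  rewrite rmorphM !rmorphXn /= -[_%:~R]/((y h)%:R : 'F_p).
  rewrite -((eqmodn_intr _ _ pp).1 (xy h)) -[_%:~R]/((x h)%:R : 'F_p) -exprD.
  rewrite subnK; last by rewrite -ltnS.
  over.
by rewrite sumr_const card_ord mulr_natl.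
Qed.

(** The key vector embeds the set into a box with sides [m l]. The common bound [N] places all keys
    in one ordinal type, so that the box becomes a [family]. *)
Lemma card_le_prod_keys (T L : finType) (A : {pred T}) (g : T -> L -> nat)
    (m : L -> nat) :
  (forall x l, (g x l < m l)%N) ->
  {in A &, forall x y, (forall l, g x l = g y l) -> x = y} ->
  (#|A| <= \prod_l m l)%N.
Proof.
move=> gm gI; pose N := (\sum_l m l)%N.
have gN x l : (g x l < N.+1)%N.
  by rewrite ltnS (leq_trans (ltnW (gm x l))) // /N (bigD1 l) //= leq_addr.
pose G x := [ffun l => inord (g x l) : 'I_N.+1].
have GI : {in A &, injective G}.
  move=> x y xA yA /ffunP Gxy; apply: gI => // l.
  by have := Gxy l; rewrite !ffunE => /(congr1 val) /=; rewrite !inordK.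
rewrite -(card_in_image GI).
pose F l : {pred 'I_N.+1} := [pred n : 'I_N.+1 | (n < m l)%N].
have -> : (\prod_l m l = #|family F|)%N.
  rewrite card_family foldrE big_map big_enum /=; apply: eq_bigr => l _.
  rewrite -[LHS]card_ord.
  have mN : (m l <= N.+1)%N by rewrite leqW // /N (bigD1 l) //= leq_addr.
  have wI : injective (widen_ord mN) by move=> u v /(congr1 val) /= /val_inj.
  rewrite -(card_codom wI); apply: eq_card => n; rewrite [RHS]inE /=.
  apply/codomP/idP => [[u ->] /=|nm]; first by case: u.
  by exists (Ordinal nm); apply/val_inj.
apply/subset_leq_card/fintype.subsetP => f /fintype.imageP[x _ ->].
by apply/familyP => l; rewrite ffunE inE inordK.
Qed.

(** A point in the class of [xi] modulo p^a: [tau] selects its class modulo p^(a+1), and [t] carries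
    the higher digits. *)
Definition lift_pt (p a xi tau t : nat) : nat := (xi + p ^ a * (tau + p * t))%N.

(* A lift is determined by the leading digits of its power sums, taken about -c
   modulo p^(kb) and then, with the variables translated by xi and divided by
   p^a, modulo p^(kb-a), where Hensel's lemma applies. *)
Lemma card_congruent_lifts (p k a b c xi : nat) (tau : 'I_k -> 'I_p)
    (t0 : {ffun 'I_k -> 'I_(p ^ (k * b - a.+1))}) :
  prime p -> (k < p)%N -> (a <= b)%N -> (a < k * b)%N -> injective tau ->
  (#|[pred t : {ffun 'I_k -> 'I_(p ^ (k * b - a.+1))} |
      [forall j : 'I_k,
        psum j.+1 (fun i => lift_pt p a xi (tau i) (t i) + c)%N ==
        psum j.+1 (fun i => lift_pt p a xi (tau i) (t0 i) + c)%N
          %[mod p ^ (j.+1 * b)]]]|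
    <= p ^ ('C(k, 2) * (a + b)))%N.
Proof.
move=> pp kp ab akb tauI; set A := [pred t | _].
have p0 n : (0 < p ^ n)%N by rewrite expn_gt0 prime_gt0.
pose N := (p ^ (k * b))%N.
pose y (t : {ffun 'I_k -> 'I_(p ^ (k * b - a.+1))}) (i : 'I_k) :=
  (tau i + p * t i)%N.
pose z (t : {ffun 'I_k -> 'I_(p ^ (k * b - a.+1))}) (i : 'I_k) :=
  (lift_pt p a xi (tau i) (t i) + c)%N.
have jkb (j : 'I_k) : (j.+1 * b <= k * b)%N by rewrite leq_mul2r ltn_ord orbT.
have jka (j : 'I_k) : (j.+1 * a <= k * b)%N by rewrite leq_mul.
pose g (t : {ffun 'I_k -> 'I_(p ^ (k * b - a.+1))}) (l : 'I_k + 'I_k) := match l with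
  | inl j => (psum j.+1 (z t) %% N %/ p ^ (j.+1 * b))%N
  | inr j => (psum j.+1 (y t) %% p ^ (k * b - a) %/ p ^ (k * b - j.+1 * a))%N
  end.
(* The sum of degree j+1 is prescribed modulo p^((j+1)b), which leaves p^(kb-(j+1)b) residues modulo
   p^(kb). Dividing the translated sum by p^((j+1)a) fixes it only modulo p^(kb-(j+1)a), which
   leaves p^(ja) residues modulo p^(kb-a). The exponents add up to C(k,2)b and C(k,2)a. *)
pose m (l : 'I_k + 'I_k) := match l with
  | inl j => (p ^ (k * b - j.+1 * b))%N | inr j => (p ^ (j * a))%N end.
have -> : (p ^ ('C(k, 2) * (a + b)) = \prod_l m l)%N.
  rewrite big_sumType /= -!expn_sum -expnD -bin2_sum; congr (p ^ _)%N.
  rewrite mulnDr addnC; congr (_ + _)%N; last first.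
    by rewrite big_mkord big_distrl.
  rewrite big_mkord (reindex_inj rev_ord_inj) big_distrl /=.
  by apply: eq_bigr => j _; rewrite mulnBl.
apply: (card_le_prod_keys (g := g)) => [t [j|j]|t t' tA t'A gtt'].
- by rewrite /g /m /= ltn_divLR // -expnD subnK // ltn_pmod ?p0.
- rewrite /g /m /= ltn_divLR // -expnD.
  have -> : (j * a + (k * b - j.+1 * a) = k * b - a)%N.
    by have := jka j; rewrite mulSn; lia.
  by rewrite ltn_pmod.
have zz j : (j <= k)%N -> psum j (z t) = psum j (z t') %[mod N].
  case: j => [|j jk]; first by rewrite !psum0.
  apply: (@eqmodn_divmod (p ^ (j.+1 * b))).
  - by rewrite dvdn_exp2l // (jkb (Ordinal jk)).
  - have := forallP tA (Ordinal jk); have := forallP t'A (Ordinal jk).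
    by move=> /eqP /= -> /eqP ->.
  - exact: gtt' (inl (Ordinal jk)).
have yy j : (j <= k)%N -> psum j (y t) = psum j (y t') %[mod p ^ (k * b - a)].
  case: j => [|j jk]; first by rewrite !psum0.
  apply: (@eqmodn_divmod (p ^ (k * b - j.+1 * a))).
  - by rewrite dvdn_exp2l // leq_sub2l // mulSn leq_addr.
  (* Adding (N-1)(xi+c) subtracts xi+c modulo N without leaving the natural numbers. *)
  - have H (u : {ffun 'I_k -> 'I_(p ^ (k * b - a.+1))}) :
        psum j.+1 (fun i => z u i + (N - 1) * (xi + c))%N =
        p ^ (j.+1 * a) * psum j.+1 (y u) %[mod N].
      rewrite [(j.+1 * a)%N]mulnC expnM -psumM; apply: eqmodn_psum => i.
      have -> : (z u i + (N - 1) * (xi + c) = p ^ a * y u i + (xi + c) * N)%N.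
        rewrite /z /lift_pt -/(y u i) /N; have := p0 (k * b)%N.
        case: (p ^ (k * b))%N => // N' _; rewrite subn1 /=; lia.
      by rewrite addnC modnMDl.
    have := eqmodn_psumD ((N - 1) * (xi + c)) zz jk; rewrite !H.
    have -> : N = (p ^ (j.+1 * a) * p ^ (k * b - j.+1 * a))%N.
      by rewrite -expnD subnKC // (jka (Ordinal jk)).
    by rewrite -!muln_modr => /eqP; rewrite eqn_pmul2l // => /eqP.
  - exact: gtt' (inr (Ordinal jk)).
have taup i : (tau i < p)%N := ltn_ord _.
have yt u i : (y u i = tau i %[mod p])%N by rewrite /y addnC mulnC modnMDl.
have yE i : (y t i = y t' i %[mod p ^ (k * b - a)])%N.
  apply: (psum_hensel pp kp _ _ yy) => [i1 i2|i1]; last by rewrite !yt.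
  by rewrite !yt !modn_small // => /val_inj/tauI.
have ylt u i : (y u i < p ^ (k * b - a))%N.
  have -> : (k * b - a = (k * b - a.+1).+1)%N by lia.
  rewrite expnS; have := ltn_ord (u i); have := taup i; rewrite /y.
  set q := (p ^ _)%N; set w := nat_of_ord (u i) => tp wq.
  have : (p * w.+1 <= p * q)%N by rewrite leq_mul2l wq orbT.
  by rewrite mulnS; lia.
apply/ffunP => i; apply/val_inj; have := yE i; rewrite !modn_small //.
by rewrite /y => /addnI/eqP; rewrite eqn_pmul2l ?prime_gt0 // => /eqP.
Qed.

(** * Elementary inequalities *)

(** Weighted AM-GM. The inductive step multiplies by v and uses that u^(n+1) - v^(n+1) and u - v
    have the same sign. *)
Lemma young_expr (R : realDomainType) (n : nat) (u v : R) : 0 <= u -> 0 <= v ->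
  n.+1%:R * (u * v ^+ n) <= u ^+ n.+1 + n%:R * v ^+ n.+1.
Proof.
move=> u0 v0; elim: n => [|n IHn].
  by rewrite mul1r expr0 mulr1 expr1 mul0r addr0.
have H : u * v ^+ n.+1 + u ^+ n.+1 * v <= u ^+ n.+2 + v ^+ n.+2.
  rewrite -subr_ge0.
  have -> : u ^+ n.+2 + v ^+ n.+2 - (u * v ^+ n.+1 + u ^+ n.+1 * v) =
            (u ^+ n.+1 - v ^+ n.+1) * (u - v) by rewrite !exprSr; ring.
  case: (leP u v) => uv.
    by rewrite mulr_le0 // subr_le0 // lerXn2r.
  by rewrite mulr_ge0 // subr_ge0 ?lerXn2r // ltW.
have e1 : n.+1%:R = n%:R + 1 :> R by rewrite natr1.
have := ler_wpM2r v0 IHn; move: H.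
rewrite -(natr1 n.+1) e1 !exprSr; lra.
Qed.

(** Hoelder's inequality with exponents n+1 and (n+1)/n. Given bounds [a] and [b] replace the roots
    of the two sums; Young's inequality is applied to x/a and y/b term by term. *)
Lemma hoelder_sum (R : realFieldType) (T : finType) (n : nat)
    (w x y : T -> R) (a b : R) :
  (forall i, 0 <= w i) -> (forall i, 0 <= x i) -> (forall i, 0 <= y i) ->
  0 < a -> 0 < b ->
  \sum_i w i * x i ^+ n.+1 <= a ^+ n.+1 ->
  \sum_i w i * y i ^+ n.+1 <= b ^+ n.+1 ->
  \sum_i w i * (x i * y i ^+ n) <= a * b ^+ n.
Proof.
move=> w0 x0 y0 a0 b0 xa yb.
have ab0 : 0 < a * b ^+ n by rewrite mulr_gt0 ?exprn_gt0.
rewrite -(ler_pM2l (ltr0Sn R n)) big_distrr /=.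
apply: (@le_trans _ _ (\sum_i (a * b ^+ n *
    (w i * x i ^+ n.+1 / a ^+ n.+1 + n%:R * (w i * y i ^+ n.+1 / b ^+ n.+1))))).
  apply: ler_sum => i _.
  have := young_expr n (divr_ge0 (x0 i) (ltW a0)) (divr_ge0 (y0 i) (ltW b0)).
  move=> /(ler_wpM2l (w0 i))/(ler_wpM2l (ltW ab0)).
  rewrite !expr_div_n => H.
  apply: (le_trans _ (le_trans H _)); rewrite le_eqVlt; apply/orP; left.
    apply/eqP; field; rewrite !expf_neq0 ?gt_eqF //.
  apply/eqP; ring.
rewrite -big_distrr /= big_split /= -big_distrr /= -!big_distrl /=.
rewrite mulrC ler_pM2r // -natr1 addrC lerD //.
  by rewrite -[leRHS]mulr1 ler_wpM2l // ler_pdivrMr ?exprn_gt0 // mul1r.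
by rewrite ler_pdivrMr ?exprn_gt0 // mul1r.
Qed.

Lemma prod_le_sum_expr (R : realDomainType) (k : nat) (t : 'I_k -> R) :
  (0 < k)%N -> (forall i, 0 <= t i) -> \prod_i t i <= \sum_i t i ^+ k.
Proof.
move=> k0 t0.
case: (@Order.TotalTheory.arg_maxP _ R 'I_k (Ordinal k0) xpredT t) => // i _ ti.
have {}ti l : t l <= t i by apply: ti.
rewrite (bigD1 i) //= [leRHS](bigD1 i) //= -[leLHS]addr0.
apply: lerD; last by apply: sumr_ge0 => l _; rewrite exprn_ge0.
rewrite -(bigD1 (P := xpredT) i) //=.
apply: (@le_trans _ _ (\prod_(l < k) t i)).
  by apply: ler_prod => l _; rewrite t0 ti.
by rewrite prodr_const card_ord.
Qed.

(* If fewer than k of the weights are at least 1/p times the largest one, then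
   the sum is at most k times the largest one; otherwise k distinct large
   weights dominate the sum up to a power of p. *)
Lemma broad_narrow (R : realFieldType) (p k m : nat) (w : 'I_p -> R) :
  (0 < p)%N -> (0 < k)%N -> (forall t, 0 <= w t) ->
  (\sum_t w t) ^+ (k * m) <=
    k%:R ^+ (k * m) * (\sum_t w t ^+ (k * m)) +
    p%:R ^+ (2 * (k * m)) *
      \sum_(tau : {ffun 'I_k -> 'I_p} | injectiveb tau) \prod_i w (tau i) ^+ m.
Proof.
move=> p0 k0 w0.
case: (@Order.TotalTheory.arg_maxP _ R 'I_p (Ordinal p0) xpredT w) => // t0 _ wt.
have {}wt t : w t <= w t0 by apply: wt.
have pR : 0 < p%:R :> R by rewrite ltr0n.
pose L := [pred t | w t0 <= p%:R * w t].
have s1 : 0 <= k%:R ^+ (k * m) * (\sum_t w t ^+ (k * m)).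
  by rewrite mulr_ge0 ?exprn_ge0 // sumr_ge0 // => t _; rewrite exprn_ge0.
have s2 (tau : {ffun 'I_k -> 'I_p}) : 0 <= \prod_i w (tau i) ^+ m.
  by apply: prodr_ge0 => i _; rewrite exprn_ge0.
have S0 : 0 <= \sum_t w t by apply: sumr_ge0.
have [kL|Lk] := leqP k #|L|.
  rewrite -[leLHS]add0r lerD //.
  have Li i : enum_val (widen_ord kL i) \in L by exact: enum_valP.
  pose tau := [ffun i : 'I_k => enum_val (widen_ord kL i) : 'I_p].
  have tauI : injectiveb tau.
    apply/injectiveP => i j; rewrite !ffunE => /enum_val_inj.
    by move=> /(congr1 val) /= /val_inj.
  rewrite (bigD1 tau) //= mulrDr -[leLHS]addr0 lerD //; last first.
    by rewrite mulr_ge0 ?exprn_ge0 ?ler0n // sumr_ge0.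
  apply: (@le_trans _ _ ((p%:R * w t0) ^+ (k * m))).
    rewrite lerXn2r ?nnegrE ?mulr_ge0 ?ler0n //.
    rewrite mulr_natl -[in leRHS](card_ord p) -sumr_const.
    by apply: ler_sum.
  apply: (@le_trans _ _ (p%:R ^+ (2 * (k * m)) * (w t0 / p%:R) ^+ (k * m))).
    rewrite le_eqVlt; apply/orP; left; apply/eqP.
    by rewrite [p%:R ^+ (2 * _)]exprM -exprMn; congr (_ ^+ _); field; rewrite gt_eqF.
  rewrite ler_wpM2l ?exprn_ge0 ?ler0n // exprM exprAC.
  rewrite -{1}(card_ord k) -prodr_const; apply: ler_prod => i _.
  rewrite !exprn_ge0 ?divr_ge0 ?ler0n //=.
  rewrite lerXn2r ?nnegrE ?divr_ge0 ?ler0n // ffunE.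
  by rewrite ler_pdivrMr // mulrC; exact: Li.
rewrite -[leLHS]addr0 lerD //; last first.
  by rewrite mulr_ge0 ?exprn_ge0 ?ler0n // sumr_ge0.
apply: (@le_trans _ _ ((k%:R * w t0) ^+ (k * m))); last first.
  rewrite exprMn ler_wpM2l ?exprn_ge0 ?ler0n // (bigD1 t0) //= lerDl.
  by apply: sumr_ge0 => t _; rewrite exprn_ge0.
(* At most k-1 large weights contribute at most k-1 times the maximum. The small ones, at most p in
   number and each below 1/p of the maximum, contribute at most the maximum once more. *)
rewrite lerXn2r ?nnegrE ?mulr_ge0 ?ler0n // (bigID L) /=.
case: k k0 Lk {s1 s2} => // k _ Lk.
rewrite -natr1 mulrDl mul1r lerD //.
  apply: (@le_trans _ _ (\sum_(t in L) w t0)); first exact: ler_sum.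
  by rewrite sumr_const -[leLHS]mulr_natl ler_wpM2r // ler_nat.
rewrite -(ler_pM2l pR) big_distrr /=.
apply: (@le_trans _ _ (\sum_(t : 'I_p) w t0)); last first.
  by rewrite sumr_const card_ord mulr_natl.
rewrite [leRHS](bigID L) /= -[leLHS]add0r lerD ?sumr_ge0 //.
by apply: ler_sum => t; rewrite -ltNge => /ltW.
Qed.

(** * Exponential sums and orthogonality *)

Local Notation nrm := ComplexField.Normc.normc.

Lemma eD (R : realType) (x y : R) : e (x + y) = e x * e y.
Proof.
rewrite /e mulrDr cosD sinD; apply/eqP; rewrite eq_complex /=.
by rewrite eqxx /= [X in X == _]addrC.
Qed.

Lemma e0 (R : realType) : e (0 : R) = 1.
Proof. by rewrite /e mulr0 cos0 sin0. Qed.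

Lemma eN (R : realType) (x : R) : e (- x) = conjc (e x).
Proof. by rewrite /e mulrN cosN sinN. Qed.

Lemma e_sum (R : realType) (I : Type) (r : seq I) (P : pred I) (F : I -> R) :
  e (\sum_(i <- r | P i) F i) = \prod_(i <- r | P i) e (F i).
Proof. by apply: (big_morph (@e R)); [exact: eD | exact: e0]. Qed.

Lemma e_natM (R : realType) (n : nat) (x : R) : e (n%:R * x) = e x ^+ n.
Proof.
elim: n => [|n IHn]; first by rewrite mul0r e0.
by rewrite -natr1 mulrDl mul1r eD IHn exprSr.
Qed.

Lemma e1 (R : realType) : e (1 : R) = 1.
Proof.
by rewrite /e mulr1 mulrC mulr_natr cos2pi sin2pi.
Qed.

Lemma e_neq1 (R : realType) (x : R) : 0 < `|x| < 1 -> e x != 1.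
Proof.
move=> /andP[x0 x1]; apply/eqP => /(congr1 (@complex.Re R)) /= c1.
have s0 : 0 < sin (pi * `|x|).
  by apply: sin_gt0_pi; rewrite mulr_gt0 ?pi_gt0 //= gtr_pMr ?pi_gt0.
have : sin (pi * x) ^+ 2 = 0.
  have := cos_mulr2n (pi * x); rewrite -[(pi * x) *+ 2]mulr_natl mulrA c1 cos2sin2 => H.
  by move: H; rewrite mulr2n; lra.
move/eqP; rewrite expf_eq0 /= => /eqP s.
move: s0; case: (ger0P x) => _; rewrite ?mulrN ?sinN s ?oppr0 ltxx //.
Qed.

(** A geometric sum of the M-th root of unity e((m-n)/M), which differs from 1 when 0 < |m-n| <
    M. *)
Lemma sum_e_eq0 (R : realType) (M m n : nat) : (m < M)%N -> (n < M)%N ->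
  \sum_(a < M) e (a%:R / M%:R * (m%:R - n%:R) : R) = (M * (m == n))%:R.
Proof.
move=> mM nM; have M0 : 0 < M%:R :> R by rewrite ltr0n; apply: leq_trans mM.
have [->|mn] := eqVneq m n.
  under eq_bigr => a _ do rewrite subrr mulr0 e0.
  by rewrite sumr_const card_ord muln1.
rewrite muln0; pose w := e ((m%:R - n%:R) / M%:R : R).
have w1 : w - 1 != 0.
  rewrite subr_eq0; apply: e_neq1.
  rewrite normrM normfV (gtr0_norm M0) ltr_pdivrMr // mul1r.
  rewrite divr_gt0 ?normr_gt0 ?subr_eq0 ?eqr_nat //=.
  case: (leqP m n) => h.
    rewrite ler0_norm ?subr_le0 ?ler_nat // opprB -natrB // ltr_nat.
    by rewrite (leq_ltn_trans (leq_subr _ _)).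
  rewrite ger0_norm ?subr_ge0 ?ler_nat // 1?ltnW // -natrB 1?ltnW // ltr_nat.
  by rewrite (leq_ltn_trans (leq_subr _ _)).
have wM : w ^+ M = 1.
  rewrite /w -e_natM mulrC divfK ?gt_eqF // eD eN.
  rewrite -[m%:R]mulr1 -[n%:R]mulr1 !e_natM e1 !expr1n.
  by rewrite conjc1 mulr1.
apply: (mulfI w1); rewrite mulr0.
under eq_bigr => a _ do rewrite -mulrA e_natM mulrC -/w.
by rewrite -subrX1 wM subrr.
Qed.

(** Unlike [weyl_sum], the range starts at 0, so that for n = p^B the residue classes modulo p^b cut
    it into intervals of equal length after division. *)
Definition wsum (R : realType) (k n : nat) (q : pred 'I_n) (alpha : 'I_k -> R) :
    R[i] :=
  \sum_(x | q x) e (\sum_j alpha j * x%:R ^+ j.+1).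

(** Variables are indexed by an arbitrary finite type, each with its own admissible set, so that one
    count covers systems mixing several kinds of variables. *)
Definition nsol (k n : nat) (L : finType) (q q' : L -> pred 'I_n) : nat :=
  #|[pred xy : {ffun L -> 'I_n} * {ffun L -> 'I_n} |
     [&& xy.1 \in family q, xy.2 \in family q' &
         [forall j : 'I_k, psum j.+1 (fun l => xy.1 l : nat) ==
                           psum j.+1 (fun l => xy.2 l : nat)]]]|.

Definition avg (R : realType) (T : finType) (g : T -> R) : R :=
  #|T|%:R^-1 * \sum_a g a.

Definition frac_pt (R : realType) (k M : nat) (a : {ffun 'I_k -> 'I_M}) :
    'I_k -> R :=
  fun j => (a j)%:R / M%:R.

Lemma prod_wsum (R : realType) (k n : nat) (L : finType) (q : L -> pred 'I_n)
    (alpha : 'I_k -> R) :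
  \prod_l wsum (q l) alpha =
  \sum_(x : {ffun L -> 'I_n} | x \in family q)
    e (\sum_j alpha j * (psum j.+1 (fun l => x l : nat))%:R).
Proof.
rewrite /wsum bigA_distr_big_dep; apply: eq_bigr => x _.
rewrite -e_sum exchange_big; congr e; apply: eq_bigr => j _.
rewrite -big_distrr /= /psum natr_sum; congr (_ * _).
by apply: eq_bigr => l _; rewrite natrX.
Qed.

(** All power sums stay below M, so an average over the grid of denominator M detects equality and
    not merely congruence. *)
Lemma psum_lt (L : finType) (n k M j : nat) (x : L -> 'I_n) :
  (#|L| * n ^ k < M)%N -> (j < k)%N -> (psum j.+1 (fun l => x l : nat) < M)%N.
Proof.
move=> LM jk; apply: leq_ltn_trans LM.
rewrite -sum_nat_const; apply: leq_sum => l _.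
have n0 : (0 < n)%N by apply: leq_ltn_trans (ltn_ord (x l)).
by rewrite (leq_trans (n := n ^ j.+1)%N) ?leq_exp2r ?leq_pexp2l // ltnW.
Qed.

Lemma Re_sum (R : realType) (I : Type) (r : seq I) (P : pred I) (F : I -> R[i]) :
  complex.Re (\sum_(i <- r | P i) F i) = \sum_(i <- r | P i) complex.Re (F i).
Proof. by apply: (big_morph (@complex.Re R)) => // -[? ?] [? ?]. Qed.

Lemma normc_sqr (R : realType) (z : R[i]) :
  nrm z ^+ 2 = complex.Re (z * conjc z).
Proof. by case: z => x y /=; rewrite sqr_sqrtr ?addr_ge0 ?sqr_ge0 // mulrN opprK. Qed.

Lemma Re_natr (R : realType) (n : nat) : complex.Re (n%:R : R[i]) = n%:R.
Proof. by elim: n => // n IHn; rewrite -natr1 -[RHS]natr1 -IHn; case: (n%:R). Qed.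

Section MeanValues.
Variables (R : realType) (k n M : nat) (L : finType).
Hypothesis LM : (#|L| * n ^ k < M)%N.
Implicit Types q : L -> pred 'I_n.

Let pt (a : {ffun 'I_k -> 'I_M}) : 'I_k -> R := frac_pt R a.

(** Once both products are expanded, the sum over the grid factors over the k coordinates, and each
    factor is an instance of [sum_e_eq0]. *)
Lemma sum_prod_wsum q q' :
  \sum_a (\prod_l wsum (q l) (pt a) * conjc (\prod_l wsum (q' l) (pt a))) =
  (M ^ k * nsol k q q')%:R.
Proof.
under eq_bigr => a _ do rewrite !prod_wsum rmorph_sum big_distrlr /=.
rewrite exchange_big /=.
under eq_bigr => x _ do rewrite exchange_big /=.
pose b (x y : {ffun L -> 'I_n}) := [forall j : 'I_k, psum j.+1 (fun l : L => x l : nat) ==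
                           psum j.+1 (fun l => y l : nat)].
have xyE (x y : {ffun L -> 'I_n}) : \sum_a
    (e (\sum_j pt a j * (psum j.+1 (fun l => x l : nat))%:R) *
     conjc (e (\sum_j pt a j * (psum j.+1 (fun l => y l : nat))%:R))) =
    (M ^ k * b x y)%:R.
  under eq_bigr => a _ do rewrite -eN -eD -sumrB e_sum.
  under eq_bigr => a _ do under eq_bigr => j _ do rewrite -mulrBr.
  rewrite -(bigA_distr_bigA (fun (j : 'I_k) (c : 'I_M) => e (c%:R / M%:R *
    ((psum j.+1 (fun l => x l : nat))%:R - (psum j.+1 (fun l => y l : nat))%:R)))).
  rewrite (eq_bigr _ (fun j _ =>
    sum_e_eq0 R (psum_lt x LM (ltn_ord j)) (psum_lt y LM (ltn_ord j)))).
  rewrite -natr_prod; congr (_%:R); rewrite big_split /= prod_nat_const card_ord.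
  congr (_ * _)%N; rewrite /b; case: (boolP [forall j, _]) => [/forallP H|].
    by rewrite big1 // => j _; rewrite H.
  by rewrite negb_forall => /existsP[j /negbTE H]; rewrite (bigD1 j) //= H.
under eq_bigr => x _ do under eq_bigr => y _ do rewrite xyE.
rewrite pair_big_dep /= -natr_sum; congr (_%:R).
rewrite -big_distrr /=; congr (_ * _)%N.
rewrite /nsol -sum1_card [RHS]big_mkcond [LHS]big_mkcond /=.
apply: eq_bigr => -[x y] _; rewrite !inE /= -/(b x y).
by case: [forall x0, x x0 \in q x0]; case: [forall x0, y x0 \in q' x0]; case: (b x y).
Qed.

Lemma M_gt0 : (0 < M)%N. Proof. by apply: leq_ltn_trans LM. Qed.

Lemma card_pts : #|{ffun 'I_k -> 'I_M}| = (M ^ k)%N.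
Proof. by rewrite card_ffun !card_ord. Qed.

Lemma avg_Re_prod_wsum q q' :
  avg (fun a => complex.Re
    (\prod_l wsum (q l) (pt a) * conjc (\prod_l wsum (q' l) (pt a)))) =
  (nsol k q q')%:R.
Proof.
rewrite /avg -Re_sum sum_prod_wsum Re_natr card_pts natrM mulKf //.
by rewrite pnatr_eq0 expn_eq0 negb_and -lt0n M_gt0.
Qed.

Lemma avg_prod_normc q :
  avg (fun a => \prod_l nrm (wsum (q l) (pt a)) ^+ 2) = (nsol k q q)%:R.
Proof.
rewrite -avg_Re_prod_wsum /avg; congr (_ * _); apply: eq_bigr => a _.
rewrite -normc_sqr prodrXl; congr (_ ^+ 2).
apply: esym; apply: (big_morph (@nrm R)); last exact: ComplexField.Normc.normc1.
exact: ComplexField.Normc.normcM.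
Qed.

(** The average of |u - v|^2 over the grid is nonnegative. *)
Lemma nsol_le_mean q q' :
  (nsol k q q' + nsol k q' q <= nsol k q q + nsol k q' q')%N.
Proof.
rewrite -(ler_nat R) !natrD -!avg_Re_prod_wsum /avg -!mulrDr -!big_split /=.
rewrite ler_wpM2l ?invr_ge0 ?ler0n //; apply: ler_sum => a _.
move: (\prod_l _) (\prod_l _) => u v; rewrite -subr_ge0.
have := sqr_ge0 (nrm (u - v)); rewrite normc_sqr.
by case: u v => u1 u2 [v1 v2] /=; rewrite !mulrN !opprK; lra.
Qed.

(** Opening the square leaves only pairs related by [r]. Each such count is dominated by the mean of
    two diagonal counts, and every [z] lies in at most [F] pairs on either side. *)
Lemma almost_orthogonality (Z : finType) (q : Z -> L -> pred 'I_n)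
    (r : rel Z) (F : nat) :
  symmetric r -> (forall z z', ~~ r z z' -> nsol k (q z) (q z') = 0%N) ->
  (forall z, #|[pred z' | r z z']| <= F)%N ->
  avg (fun a => nrm (\sum_z \prod_l wsum (q z l) (pt a)) ^+ 2) <=
  F%:R * \sum_z avg (fun a => \prod_l nrm (wsum (q z l) (pt a)) ^+ 2).
Proof.
move=> rC r0 rF.
have -> : avg (fun a => nrm (\sum_z \prod_l wsum (q z l) (pt a)) ^+ 2) =
    (\sum_z \sum_z' nsol k (q z) (q z'))%N%:R.
  rewrite natr_sum; under [RHS]eq_bigr => z _ do rewrite natr_sum.
  under [RHS]eq_bigr => z _ do under eq_bigr => z' _ do
    rewrite -avg_Re_prod_wsum /avg.
  under [RHS]eq_bigr => z _ do rewrite -big_distrr /=.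
  rewrite -big_distrr /= /avg; congr (_ * _).
  under [RHS]eq_bigr => z _ do rewrite exchange_big /=.
  rewrite [RHS]exchange_big /=; apply: eq_bigr => a _.
  rewrite normc_sqr rmorph_sum big_distrlr /= Re_sum.
  by apply: eq_bigr => z _; rewrite Re_sum.
under [X in _ <= _ * X]eq_bigr => z _ do rewrite avg_prod_normc.
(* Doubling pairs the term (z,z') with (z',z), since [nsol_le_mean] bounds only their sum. *)
rewrite -natr_sum -natrM ler_nat -leq_double -!addnn.
rewrite {2}exchange_big -big_split /=.
under eq_bigr => z _ do rewrite -big_split /=.
pose D z := nsol k (q z) (q z).
apply: (@leq_trans (\sum_z \sum_(z' | r z z') (D z + D z'))%N).
  apply: leq_sum => z _; rewrite [leqRHS]big_mkcond; apply: leq_sum => z' _.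
  case: ifPn => [_|rz]; first exact: nsol_le_mean.
  by rewrite !r0 // rC.
under eq_bigr => z _ do rewrite big_split /=.
rewrite big_split leq_add //.
  rewrite big_distrr; apply: leq_sum => z _ /=.
  by rewrite sum_nat_const leq_mul2r rF orbT.
rewrite (exchange_big_dep xpredT) //= big_distrr; apply: leq_sum => z _ /=.
rewrite sum_nat_const leq_mul2r (leq_trans _ (rF z)) ?orbT //.
by apply/eq_leq/eq_card => z'; rewrite !inE rC.
Qed.

End MeanValues.

(** * Counting solutions and averages *)

Lemma ler_sum_ord (R : numDomainType) (n : nat) (F : 'I_n -> R) (c : R) :
  (forall i, F i <= c) -> \sum_i F i <= n%:R * c.
Proof.
move=> Fc; rewrite mulr_natl -[X in _ *+ X]card_ord -sumr_const.
exact: ler_sum.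
Qed.

Section Averages.
Variables (R : realType) (T : finType).
Implicit Types g h : T -> R.

Lemma ler_avg g h : (forall a, g a <= h a) -> avg g <= avg h.
Proof. by move=> gh; rewrite ler_wpM2l ?invr_ge0 ?ler0n // ler_sum. Qed.

Lemma avgD g h : avg (fun a => g a + h a) = avg g + avg h.
Proof. by rewrite /avg big_split mulrDr. Qed.

Lemma avgZ c g : avg (fun a => c * g a) = c * avg g.
Proof. by rewrite /avg -big_distrr mulrCA. Qed.

Lemma avg_sum (I : finType) (P : pred I) (F : I -> T -> R) :
  avg (fun a => \sum_(i | P i) F i a) = \sum_(i | P i) avg (F i).
Proof. by rewrite /avg exchange_big big_distrr. Qed.

Lemma hoelder_avg (n : nat) (w x y : T -> R) (a b : R) :
  (forall i, 0 <= w i) -> (forall i, 0 <= x i) -> (forall i, 0 <= y i) ->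
  0 < a -> 0 < b ->
  avg (fun i => w i * x i ^+ n.+1) <= a ^+ n.+1 ->
  avg (fun i => w i * y i ^+ n.+1) <= b ^+ n.+1 ->
  avg (fun i => w i * (x i * y i ^+ n)) <= a * b ^+ n.
Proof.
move=> w0 x0 y0 a0 b0; rewrite /avg !big_distrr /= => xa yb.
have cw i z : #|T|%:R^-1 * (w i * z) = (#|T|%:R^-1 * w i) * z by rewrite mulrA.
rewrite (eq_bigr _ (fun i _ => cw i _)) in xa.
rewrite (eq_bigr _ (fun i _ => cw i _)) in yb.
rewrite (eq_bigr _ (fun i _ => cw i _)).
by apply: hoelder_sum xa yb => // i; rewrite mulr_ge0 ?invr_ge0 ?ler0n.
Qed.

End Averages.

Definition res_class (p n b eta : nat) : pred 'I_n :=
  [pred x : 'I_n | x == eta %[mod p ^ b]].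

Definition vino_count (S k n : nat) : nat := nsol k (fun _ : 'I_S => @predT 'I_n)
  (fun _ => @predT 'I_n).

Lemma wsum_split (R : realType) (k p n b c eta : nat) (alpha : 'I_k -> R) :
  (0 < p)%N ->
  wsum (@res_class p n b eta) alpha =
  \sum_(t < p ^ c) wsum (@res_class p n (b + c) (eta + p ^ b * t)) alpha.
Proof.
move=> p0; have pn d : (0 < p ^ d)%N by rewrite expn_gt0 p0.
(* [u x] represents x - eta modulo p^(b+c); its quotient by p^b names the finer class. *)
pose u (x : 'I_n) := (x + (p ^ (b + c) - 1) * eta)%N.
pose t (x : 'I_n) : 'I_(p ^ c) := Ordinal (ltn_pmod (u x %/ p ^ b) (pn c)).
rewrite /wsum (partition_big t xpredT) //=; apply: eq_bigr => d _.
apply: eq_bigl => x; rewrite /res_class /=.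
have uE : (u x + eta = x + eta * p ^ (b + c))%N.
  rewrite /u; have := pn (b + c)%N; case: (p ^ _)%N => // m _.
  by rewrite subn1 /=; lia.
have uD : (u x + eta = x %[mod p ^ (b + c)])%N by rewrite uE addnC modnMDl.
have bc : (p ^ b %| p ^ (b + c))%N by rewrite dvdn_exp2l // leq_addr.
have ub : (x == eta %[mod p ^ b]) = (p ^ b %| u x)%N.
  have -> : (x == eta %[mod p ^ b]) = (u x + eta == 0 + eta %[mod p ^ b])%N.
    by rewrite -(modn_dvdm _ bc) -uD modn_dvdm.
  by rewrite eqn_modDr mod0n.
have -> : (x == eta + p ^ b * d %[mod p ^ (b + c)])%N =
          (u x == p ^ b * d %[mod p ^ (b + c)])%N.
  by rewrite -uD [(eta + _)%N]addnC eqn_modDr.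
have dE : (p ^ b * d < p ^ (b + c))%N by rewrite expnD ltn_pmul2l.
rewrite (modn_small dE) ub -val_eqE /= modn_divl [(p ^ c * _)%N]mulnC -expnD.
apply/andP/eqP => [[bu /eqP <-]|uu].
  by rewrite mulnC divnK // /dvdn modn_dvdm.
rewrite uu mulKn //; split=> //; rewrite /dvdn -(modn_dvdm _ bc) uu.
by rewrite modnMr.
Qed.

Lemma leq_card_inj (T T' : finType) (A : {pred T}) (B : {pred T'}) (f : T -> T') :
  {in A &, injective f} -> {in A, forall x, f x \in B} -> (#|A| <= #|B|)%N.
Proof.
move=> fI AB; rewrite -(card_in_image fI).
by apply/subset_leq_card/fintype.subsetP => y /fintype.imageP[x xA ->]; apply: AB.
Qed.

(* Translation-dilation invariance: x = r + p^b y reduces the count over a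
   class modulo p^b to a count over an interval. *)
Lemma nsol_class_le (S k p b B eta : nat) : (0 < p)%N -> (b <= B)%N ->
  (nsol k (fun _ : 'I_S => @res_class p (p ^ B) b eta)
          (fun _ => @res_class p (p ^ B) b eta)
   <= vino_count S k (p ^ (B - b)))%N.
Proof.
move=> p0 bB; have pn d : (0 < p ^ d)%N by rewrite expn_gt0 p0.
have xp (x : 'I_(p ^ B)) : (x %/ p ^ b < p ^ (B - b))%N.
  by rewrite ltn_divLR // -expnD subnK.
pose D (x : {ffun 'I_S -> 'I_(p ^ B)}) := [ffun l => Ordinal (xp (x l))].
have xE (x : {ffun 'I_S -> 'I_(p ^ B)}) :
    x \in family (fun _ : 'I_S => @res_class p (p ^ B) b eta) ->
    forall l, (x l = eta %% p ^ b + p ^ b * D x l :> nat)%N.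
  move=> /familyP xF l; have := xF l; rewrite inE => /eqP <-.
  by rewrite ffunE /= addnC mulnC -divn_eq.
have psD (x : {ffun 'I_S -> 'I_(p ^ B)}) N j : (0 < N)%N ->
    x \in family (fun _ : 'I_S => @res_class p (p ^ B) b eta) ->
    psum j (fun l => x l + (N - 1) * (eta %% p ^ b))%N =
    p ^ (b * j) * psum j (fun l => D x l : nat) %[mod N].
  move=> N0 xF; rewrite expnM -psumM; apply: eqmodn_psum => l.
  have -> : (x l + (N - 1) * (eta %% p ^ b) =
             (eta %% p ^ b) * N + p ^ b * D x l)%N.
    rewrite xE //; case: N N0 => // N _; rewrite subn1 /=; move: (_ %% _)%N.
    by move: (p ^ b * _)%N; lia.
  by rewrite modnMDl.
apply: (@leq_card_inj _ _ _ _ (fun xy => (D xy.1, D xy.2))).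
  move=> [x y] [x' y']; rewrite !inE /= => /and3P[xF yF _] /and3P[x'F y'F _].
  case=> Dx Dy; congr (_, _); apply/ffunP => l; apply/val_inj.
    by rewrite /= xE // Dx -xE.
  by rewrite /= xE // Dy -xE.
move=> [x y]; rewrite !inE /= => /and3P[xF yF /forallP xy].
apply/and3P; split; [by apply/forallP | by apply/forallP | apply/forallP => j].
have {}xy i : (i <= k)%N ->
    psum i (fun l => x l : nat) = psum i (fun l => y l : nat).
  by case: i => [|i ik]; [rewrite !psum0 | exact/eqP/(xy (Ordinal ik))].
set P := psum _ _; set Q := psum _ _.
(* This modulus exceeds both dilated sums, so the congruence between them is an equality. *)
pose N := (p ^ (b * j.+1) * P + p ^ (b * j.+1) * Q).+1.
have : (p ^ (b * j.+1) * P = p ^ (b * j.+1) * Q %[mod N])%N.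
  rewrite -!psD //; apply: (@eqmodn_psumD _ k) => // i ik.
  by rewrite xy.
rewrite !modn_small ?ltnS ?leq_addr ?leq_addl // => /eqP.
by rewrite eqn_pmul2l.
Qed.

Lemma leq_vino_count (S k m n : nat) : (m <= n)%N ->
  (vino_count S k m <= vino_count S k n)%N.
Proof.
move=> mn; pose D (x : {ffun 'I_S -> 'I_m}) := [ffun l => widen_ord mn (x l)].
have DE (x : {ffun 'I_S -> 'I_m}) l : D x l = x l :> nat by rewrite ffunE.
have DI : injective D.
  move=> x y xy; apply/ffunP => l; apply/val_inj.
  by rewrite /= -(DE x) -(DE y) xy.
apply: (@leq_card_inj _ _ _ _ (fun xy => (D xy.1, D xy.2))).
  by move=> [x y] [x' y'] _ _ [/DI -> /DI ->].
move=> [x y]; rewrite !inE /= => /and3P[_ _ /forallP xy].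
apply/and3P; split; [by apply/forallP | by apply/forallP | apply/forallP => j].
rewrite /psum; under eq_bigr => l _ do rewrite DE.
by under [X in _ == X]eq_bigr => l _ do rewrite DE; exact: xy.
Qed.

Lemma vino_count_le_expn (S k n : nat) : (vino_count S k n <= n ^ (2 * S))%N.
Proof.
apply: leq_trans (max_card _) _.
by rewrite card_prod !card_ffun !card_ord -expnD mul2n addnn.
Qed.

(** * Mixed mean values *)

Section Congruencing.
Variables (R : realType) (k p B : nat).

Local Notation S := (k * k.+1)%N.
Local Notation M := (S * (p ^ B) ^ k).+1.
Local Notation J n := ((vino_count S k (p ^ n))%:R : R).

Definition class_sum (b eta : nat) (a : {ffun 'I_k -> 'I_M}) : R :=
  nrm (wsum (@res_class p (p ^ B) b eta) (frac_pt R a)).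
Local Notation v := class_sum.

Definition mixed_mean (a b xi : nat) (tau : 'I_k -> 'I_p) (eta : nat) : R :=
  avg (fun z => (\prod_i v a.+1 (xi + p ^ a * tau i) z ^+ 2) *
                v b eta z ^+ (k * (2 * k))).

(** The broad part of [mixed_mean]: the exponent 2k^2 is shared equally among k classes modulo
    p^(b+1) inside that of [eta]. *)
Definition conditioned_mean (a b xi : nat) (tau : 'I_k -> 'I_p) (eta : nat)
    (tau' : 'I_k -> 'I_p) : R :=
  avg (fun z => (\prod_i v a.+1 (xi + p ^ a * tau i) z ^+ 2) *
                \prod_i v b.+1 (eta + p ^ b * tau' i) z ^+ (2 * k)).

Lemma normc_ge0 (z : R[i]) : 0 <= nrm z.
Proof. by case: z => x y; exact: sqrtr_ge0. Qed.

Lemma class_sum_ge0 b eta z : 0 <= v b eta z.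
Proof. exact: normc_ge0. Qed.
Hint Resolve class_sum_ge0 : core.

Lemma normc_sum (I : finType) (F : I -> R[i]) :
  nrm (\sum_i F i) <= \sum_i nrm (F i).
Proof.
elim/big_ind2: _ => [|x1 x2 y1 y2 h1 h2|//].
  by rewrite ComplexField.Normc.normc0.
by apply: le_trans (lerD h1 h2); apply: le_normcD.
Qed.

Lemma normc_prod (I : finType) (F : I -> R[i]) :
  nrm (\prod_i F i) = \prod_i nrm (F i).
Proof.
apply: (big_morph (@nrm R)); last exact: ComplexField.Normc.normc1.
exact: ComplexField.Normc.normcM.
Qed.

Lemma normcX (z : R[i]) n : nrm (z ^+ n) = nrm z ^+ n.
Proof.
elim: n => [|n IHn]; first exact: ComplexField.Normc.normc1.
by rewrite !exprS ComplexField.Normc.normcM IHn.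
Qed.

Lemma class_sum_split b eta z : (0 < p)%N ->
  v b eta z <= \sum_(t < p) v b.+1 (eta + p ^ b * t) z.
Proof.
move=> p0; rewrite /v (@wsum_split R k p _ b 1 eta _ p0) addn1 expn1.
exact: normc_sum.
Qed.

Lemma avg_class_sum_eq b eta :
  avg (fun z => v b eta z ^+ (2 * S)) =
  (nsol k (fun _ : 'I_S => @res_class p (p ^ B) b eta)
          (fun _ => @res_class p (p ^ B) b eta))%:R.
Proof.
have LM : (#|'I_S| * (p ^ B) ^ k < M)%N by rewrite card_ord.
rewrite -(avg_prod_normc R LM); congr avg; apply/boolp.funext => z.
by rewrite prodr_const card_ord -exprM.
Qed.

Lemma avg_class_sum b eta : (0 < p)%N -> (b <= B)%N ->
  avg (fun z => v b eta z ^+ (2 * S)) <= J (B - b)%N.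
Proof. by move=> p0 bB; rewrite avg_class_sum_eq ler_nat nsol_class_le. Qed.

Lemma vino_count_avg : (vino_count S k (p ^ B))%:R = avg (fun z => v 0 0 z ^+ (2 * S)).
Proof.
rewrite avg_class_sum_eq; congr (_%:R); rewrite /vino_count.
have -> // : (fun _ : 'I_S => @predT 'I_(p ^ B) : pred _) =
             (fun _ => @res_class p (p ^ B) 0 0).
apply/boolp.funext => l; apply/boolp.funext => x.
by rewrite /res_class /= expn0 !modn1.
Qed.

(** The product of k squares is at most a sum of 2k-th powers; Hoelder with exponents k+1 and
    (k+1)/k then separates the scales a+1 and b into means of full order. [Q1] and [Q2] stand for
    roots. *)
Lemma mixed_mean_trivial a b xi tau eta (Q1 Q2 : R) :
  (0 < k)%N -> (0 < p)%N -> (a < B)%N -> (b <= B)%N -> 0 < Q1 -> 0 < Q2 ->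
  J (B - a.+1)%N <= Q1 ^+ k.+1 -> J (B - b)%N <= Q2 ^+ k.+1 ->
  mixed_mean a b xi tau eta <= k%:R * (Q1 * Q2 ^+ k).
Proof.
move=> k0 p0 aB bB Q10 Q20 J1 J2.
apply: (@le_trans _ _ (avg (fun z => \sum_(i < k)
    v a.+1 (xi + p ^ a * tau i) z ^+ (2 * k) * v b eta z ^+ (k * (2 * k))))).
  apply: ler_avg => z; rewrite -big_distrl /= ler_wpM2r ?exprn_ge0 //.
  apply: le_trans (prod_le_sum_expr k0 _) _ => [i|]; first by rewrite exprn_ge0.
  by apply: ler_sum => i _; rewrite exprM.
rewrite avg_sum; apply: ler_sum_ord => i.
have E2 c eta' : (fun z => 1 * (v c eta' z ^+ (2 * k)) ^+ k.+1) =
                 (fun z => v c eta' z ^+ (2 * S)).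
  by apply/boolp.funext => z; rewrite mul1r -exprM -mulnA.
rewrite [leLHS](_ : _ = avg (fun z => 1 *
    (v a.+1 (xi + p ^ a * tau i) z ^+ (2 * k) * (v b eta z ^+ (2 * k)) ^+ k))); last first.
  by congr avg; apply/boolp.funext => z; rewrite mul1r -exprM [(2 * k * k)%N]mulnC.
apply: (hoelder_avg (w := fun=> 1)
    (x := fun z => v a.+1 (xi + p ^ a * tau i) z ^+ (2 * k))
    (y := fun z => v b eta z ^+ (2 * k))) => // [z|z||]; rewrite ?exprn_ge0 // E2.
  by apply: le_trans J1; exact: avg_class_sum.
by apply: le_trans J2; exact: avg_class_sum.
Qed.

(** [broad_narrow] is applied to the p subclasses of [eta] modulo p^(b+1). The narrow terms are
    mixed means at the next scale, and there are at most p^k broad ones. *)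
Lemma mixed_mean_broad_narrow a b xi tau eta (Z1 Z2 : R) :
  (0 < k)%N -> (0 < p)%N -> 0 <= Z2 ->
  (forall eta', mixed_mean a b.+1 xi tau eta' <= Z1) ->
  (forall tau', injective tau' -> conditioned_mean a b xi tau eta tau' <= Z2) ->
  mixed_mean a b xi tau eta <=
    k%:R ^+ (k * (2 * k)) * (p%:R * Z1) +
    p%:R ^+ (2 * (k * (2 * k))) * (p%:R ^+ k * Z2).
Proof.
move=> k0 p0 Z20 h1 h2; set W := fun z => \prod_i v a.+1 (xi + p ^ a * tau i) z ^+ 2.
have W0 z : 0 <= W z by apply: prodr_ge0 => i _; rewrite exprn_ge0.
apply: (@le_trans _ _ (avg (fun z => k%:R ^+ (k * (2 * k)) *
    (\sum_(t < p) W z * v b.+1 (eta + p ^ b * t) z ^+ (k * (2 * k))) +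
    p%:R ^+ (2 * (k * (2 * k))) *
    (\sum_(tau' : {ffun 'I_k -> 'I_p} | injectiveb tau')
       W z * \prod_i v b.+1 (eta + p ^ b * tau' i) z ^+ (2 * k))))).
  apply: ler_avg => z; rewrite -!big_distrr /= !(mulrCA _ (W z)) -mulrDr.
  rewrite ler_wpM2l //; first exact: (W0 z).
  have := broad_narrow (2 * k) p0 k0
    (fun t => class_sum_ge0 b.+1 (eta + p ^ b * t) z). apply: le_trans.
  by rewrite lerXn2r ?nnegrE ?sumr_ge0 ?class_sum_split //.
rewrite avgD !avgZ !avg_sum lerD // ler_wpM2l ?exprn_ge0 ?ler0n //.
  by apply: ler_sum_ord => t; exact: h1.
apply: (@le_trans _ _ (\sum_(tau' : {ffun 'I_k -> 'I_p}) Z2)).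
  rewrite big_mkcond; apply: ler_sum => tau' _.
  by case: ifP => // /injectiveP/h2.
by rewrite sumr_const card_ffun !card_ord -natrX [leRHS]mulr_natl.
Qed.

(** The same dichotomy at scale 0. In a broad term each class has exponent 2 + 2k: the squares form
    the conditioned product, and the 2k-th powers are merged into a single class. *)
Lemma vino_count_broad_narrow (Z : R) :
  (0 < k)%N -> (0 < p)%N -> (0 < B)%N -> 0 <= Z ->
  (forall xi tau eta, injective tau -> mixed_mean 0 1 xi tau eta <= Z) ->
  J B <= k%:R ^+ (k * (2 * k.+1)) * (p%:R * J (B - 1)%N) +
         p%:R ^+ (2 * (k * (2 * k.+1))) * (p%:R ^+ k * (k%:R * Z)).
Proof.
move=> k0 p0 B0 Z0 h; rewrite vino_count_avg.
have E2 : (2 * S = k * (2 * k.+1))%N by rewrite mulnCA.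
apply: (@le_trans _ _ (avg (fun z => k%:R ^+ (k * (2 * k.+1)) *
    (\sum_(t < p) v 1 t z ^+ (2 * S)) +
    p%:R ^+ (2 * (k * (2 * k.+1))) *
    (\sum_(tau : {ffun 'I_k -> 'I_p} | injectiveb tau)
       \prod_i v 1 (tau i) z ^+ (2 * k.+1))))).
  apply: ler_avg => z.
  have := broad_narrow (2 * k.+1) p0 k0 (fun t => class_sum_ge0 1 t z).
  rewrite -E2; apply: le_trans.
  rewrite lerXn2r ?nnegrE ?sumr_ge0 //.
  apply: le_trans (class_sum_split _ _ _ p0) _; apply: ler_sum => t _.
  by rewrite add0n expn0 mul1n.
rewrite avgD !avgZ !avg_sum lerD // ler_wpM2l ?exprn_ge0 ?ler0n //.
  by apply: ler_sum_ord => t; exact: avg_class_sum.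
apply: (@le_trans _ _ (\sum_(tau : {ffun 'I_k -> 'I_p}) k%:R * Z)); last first.
  by rewrite sumr_const card_ffun !card_ord -natrX [leRHS]mulr_natl.
rewrite big_mkcond; apply: ler_sum => tau _.
case: ifP => [/injectiveP tauI|_]; last by rewrite mulr_ge0 ?ler0n.
apply: (@le_trans _ _ (avg (fun z => \sum_(i < k)
    (\prod_i v 1 (0 + p ^ 0 * tau i) z ^+ 2) * v 1 (tau i) z ^+ (k * (2 * k))))).
  apply: ler_avg => z; rewrite -big_distrr /=.
  under eq_bigr => i _ do rewrite mulnS exprD.
  rewrite big_split /=.
  under [X in _ <= X * _]eq_bigr => i _ do rewrite add0n expn0 mul1n.
  rewrite ler_wpM2l ?prodr_ge0 // => [i _|]; first by rewrite exprn_ge0.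
  apply: le_trans (prod_le_sum_expr k0 _) _ => [i|]; first by rewrite exprn_ge0.
  by apply: ler_sum => i _; rewrite -exprM [(2 * k * k)%N]mulnC.
by rewrite avg_sum; apply: ler_sum_ord => i; exact: h.
Qed.

End Congruencing.

(** * Efficient congruencing *)

Section EfficientCongruencing.
Variables (R : realType) (k p B : nat).

Local Notation S := (k * k.+1)%N.
Local Notation M := (S * (p ^ B) ^ k).+1.
Local Notation J n := ((vino_count S k (p ^ n))%:R : R).
Local Notation v := (@class_sum R k p B).
Local Notation slot := ('I_k + 'I_k * 'I_k)%type.

Variables (a b xi eta : nat) (tau tau' : 'I_k -> 'I_p).
Hypotheses (pp : prime p) (kp : (k < p)%N) (k1 : (1 < k)%N).
Hypotheses (ab : (a <= b)%N) (b0 : (0 < b)%N) (kbB : (k * b <= B)%N).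
Hypothesis tauI : injective tau.

Let r := (k * b - a.+1)%N.
Let lifts := {ffun 'I_k -> 'I_(p ^ r)}.

Lemma card_slot : #|{: slot}| = S.
Proof. by rewrite card_sum card_prod !card_ord mulnS. Qed.

Let akb : (a < k * b)%N.
Proof. by rewrite (leq_ltn_trans ab) // -[ltnLHS]mul1n ltn_pmul2r. Qed.

(** Each class modulo p^(b+1) receives k slots because |f|^(2k) is the square of |f^k|. *)
Let lift_class (t : lifts) (l : slot) : pred 'I_(p ^ B) :=
  match l with
  | inl i => @res_class p (p ^ B) (k * b) (lift_pt p a xi (tau i) (t i))
  | inr ij => @res_class p (p ^ B) b.+1 (eta + p ^ b * tau' ij.1)
  end.

(* Adding shift amounts to subtracting eta modulo p^(kb). *)
Let shift := ((p ^ (k * b) - 1) * eta)%N.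

Let lift_rel (t t' : lifts) : bool :=
  [forall j : 'I_k,
    psum j.+1 (fun i => lift_pt p a xi (tau i) (t' i) + shift)%N ==
    psum j.+1 (fun i => lift_pt p a xi (tau i) (t i) + shift)%N
      %[mod p ^ (j.+1 * b)]].

Lemma psum_sum (I1 I2 : finType) j (x : I1 + I2 -> nat) :
  psum j x = (psum j (fun i => x (inl i)) + psum j (fun i => x (inr i)))%N.
Proof. by rewrite /psum big_sumType. Qed.

(** The other k^2 variables are congruent to [eta] modulo p^b. After the shift their powers of
    degree j+1 are divisible by p^((j+1)b) and drop out. *)
Let psum_lift (t : lifts) (x : {ffun slot -> 'I_(p ^ B)}) (j : 'I_k) :
  x \in family (lift_class t) ->
  psum j.+1 (fun l => x l + shift)%N =
  psum j.+1 (fun i => lift_pt p a xi (tau i) (t i) + shift)%N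
    %[mod p ^ (j.+1 * b)].
Proof.
move=> /familyP xF; have jk : (j.+1 * b <= k * b)%N by rewrite leq_mul2r ltn_ord orbT.
have H1 : psum j.+1 (fun ij => x (inr ij) + shift)%N = 0 %[mod p ^ (j.+1 * b)].
  apply/eqP; rewrite mod0n; apply: dvdn_sum => ij _.
  rewrite mulnC expnM dvdn_exp2r //.
  have := xF (inr ij); rewrite inE /= => /eqP/(congr1 (fun z => z %% p ^ b)%N).
  rewrite !modn_dvdm ?dvdn_exp2l // => xe.
  rewrite /dvdn -modnDml xe modnDml /shift.
  have -> : (eta + p ^ b * tau' ij.1 + (p ^ (k * b) - 1) * eta =
             p ^ b * tau' ij.1 + p ^ (k * b) * eta)%N.
    have : (0 < p ^ (k * b))%N by rewrite expn_gt0 prime_gt0.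
    case: (p ^ (k * b))%N => // m _; rewrite subn1 /=.
    by move: (p ^ b * _)%N; lia.
  have bkb : (b <= k * b)%N by rewrite leq_pmull // ltnW.
  by rewrite -(subnKC bkb) expnD -mulnA -mulnDr modnMr.
rewrite psum_sum -modnDmr H1 mod0n addn0.
apply: eqmodn_psum => i; rewrite -modnDml -[RHS]modnDml; congr ((_ + _) %% _)%N.
have := xF (inl i); rewrite inE /= => /eqP.
move=> /(congr1 (fun z => z %% p ^ (j.+1 * b))%N).
by rewrite !modn_dvdm ?dvdn_exp2l.
Qed.

Let nsol_lift_eq0 t t' : ~~ lift_rel t t' ->
  nsol k (lift_class t) (lift_class t') = 0%N.
Proof.
apply: contraNeq; rewrite -lt0n => /card_gt0P[[x y]].
rewrite !inE /= => /and3P[xF yF /forallP xy]; apply/forallP => j.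
rewrite -(psum_lift j (t := t) (x := x)) // -(psum_lift j (t := t') (x := y)) //.
apply/eqP; apply: (@eqmodn_psumD _ k); last exact: ltn_ord.
case=> [|i ik]; first by rewrite !psum0.
by have /eqP /= -> := xy (Ordinal ik).
Qed.

Let LM : (#|{: slot}| * (p ^ B) ^ k < M)%N.
Proof. by rewrite card_slot. Qed.

Let prod_lift_class (A : comRingType) (F : pred 'I_(p ^ B) -> A) t :
  \prod_l F (lift_class t l) =
  (\prod_i F (@res_class p (p ^ B) (k * b) (lift_pt p a xi (tau i) (t i)))) *
  \prod_i F (@res_class p (p ^ B) b.+1 (eta + p ^ b * tau' i)) ^+ k.
Proof.
rewrite big_sumType /=; congr (_ * _).
rewrite -(pair_bigA _ (fun i (j : 'I_k) => F (@res_class p (p ^ B) b.+1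
  (eta + p ^ b * tau' i)))) /=.
by apply: eq_bigr => i _; rewrite prodr_const card_ord.
Qed.

Let wsum_lift (al : 'I_k -> R) i :
  wsum (@res_class p (p ^ B) a.+1 (xi + p ^ a * tau i)) al =
  \sum_(d < p ^ r) wsum (@res_class p (p ^ B) (k * b) (lift_pt p a xi (tau i) d)) al.
Proof.
rewrite (@wsum_split R k p _ _ r) ?prime_gt0 //; apply: eq_bigr => d _.
rewrite subnKC //; congr wsum; congr res_class.
by rewrite /lift_pt mulnDr addnA expnSr !mulnA.
Qed.

(** Splitting the first k sums into classes modulo p^(kb) gives a sum over p^(rk) lifts. Two lifts
    interact only if their power sums about [eta] agree, so almost orthogonality costs the bound of
    [card_congruent_lifts]. *)
Lemma conditioned_mean_le_lifts (Z : R) :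
  (forall t : lifts,
    avg (fun z => (\prod_i v (k * b) (lift_pt p a xi (tau i) (t i)) z ^+ 2) *
                  \prod_i v b.+1 (eta + p ^ b * tau' i) z ^+ (2 * k)) <= Z) ->
  conditioned_mean R B a b xi tau eta tau' <=
    (p ^ ('C(k, 2) * (a + b)))%:R * ((p ^ (r * k))%:R * Z).
Proof.
move=> hZ; have p0 := prime_gt0 pp.
have lift_relC : symmetric lift_rel.
  by move=> t t'; apply: eq_forallb => j; rewrite eq_sym.
have lift_card t : (#|[pred t' | lift_rel t t']| <= p ^ ('C(k, 2) * (a + b)))%N.
  exact: (@card_congruent_lifts p k a b shift xi tau t pp kp ab akb tauI).
have := almost_orthogonality R LM lift_relC nsol_lift_eq0 lift_card.
have -> : avg (fun z : {ffun 'I_k -> 'I_M} =>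
    nrm (\sum_t \prod_l wsum (lift_class t l) (frac_pt R z)) ^+ 2) =
    conditioned_mean R B a b xi tau eta tau'.
  rewrite /conditioned_mean; congr avg; apply/boolp.funext => z.
  rewrite (eq_bigr _ (fun t _ =>
    prod_lift_class (fun q => wsum q (frac_pt R z)) t)) /=.
  rewrite -big_distrl /= -(bigA_distr_bigA (fun i (d : 'I_(p ^ r)) =>
    wsum (@res_class p (p ^ B) (k * b) (lift_pt p a xi (tau i) d)) (frac_pt R z))).
  under eq_bigr => i _ do rewrite -wsum_lift.
  rewrite ComplexField.Normc.normcM !normc_prod exprMn; congr (_ * _).
    by rewrite -prodrXl.
  rewrite -prodrXl; apply: eq_bigr => i _; rewrite /class_sum.
  rewrite [(2 * k)%N]mulnC exprM; congr (_ ^+ _).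
  exact: normcX.
move=> H; apply: le_trans H _; rewrite ler_wpM2l ?ler0n //.
apply: (@le_trans _ _ (\sum_(t : lifts) Z)); last first.
  by rewrite sumr_const card_ffun !card_ord -expnM [leRHS]mulr_natl.
apply: ler_sum => t _; apply: le_trans (hZ t); apply: ler_avg => z.
rewrite (prod_lift_class (fun q => nrm (wsum q (frac_pt R z)) ^+ 2) t) /=.
by under [X in _ * X <= _]eq_bigr => i _ do rewrite -exprM.
Qed.

(** With [W] the product of squares over the broad classes, Hoelder with weight [W] and exponents k
    and k/(k-1) separates W|f|^(2k^2), a mixed mean at scales (b,kb), from W^(k+1), which single
    classes modulo p^(b+1) bound. *)
Lemma conditioned_mean_le (Z Q : R) : 0 < Z -> 0 < Q ->
  (forall eta', mixed_mean R B b (k * b) eta tau' eta' <= Z ^+ k) ->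
  J (B - b.+1)%N <= Q ^+ k ->
  conditioned_mean R B a b xi tau eta tau' <=
    (p ^ ('C(k, 2) * (a + b)))%:R *
    ((p ^ (r * k))%:R * (k%:R * (Z * (k%:R * Q) ^+ k.-1))).
Proof.
move=> Z0 Q0 hI hJ; have p0 := prime_gt0 pp; have k0 := ltnW k1.
apply: conditioned_mean_le_lifts => t.
pose W z := \prod_i v b.+1 (eta + p ^ b * tau' i) z ^+ 2.
have W0 z : 0 <= W z by apply: prodr_ge0 => i _; rewrite exprn_ge0 ?class_sum_ge0.
have WX n z : W z ^+ n = \prod_i v b.+1 (eta + p ^ b * tau' i) z ^+ (2 * n).
  by rewrite -prodrXl; apply: eq_bigr => i _; rewrite exprM.
apply: (@le_trans _ _ (avg (fun z => \sum_(i < k)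
  W z * (v (k * b) (lift_pt p a xi (tau i) (t i)) z ^+ (2 * k) * W z ^+ k.-1)))).
  apply: ler_avg => z; have Wk : W z ^+ k = W z * W z ^+ k.-1 by rewrite -exprS prednK.
  rewrite -WX Wk.
  rewrite -big_distrr /= -big_distrl /= mulrCA ler_wpM2l ?W0 //.
  rewrite ler_wpM2r ?exprn_ge0 ?W0 //.
  apply: le_trans (prod_le_sum_expr k0 _) _ => [i|]; first by rewrite exprn_ge0 ?class_sum_ge0.
  by apply: ler_sum => i _; rewrite exprM.
rewrite avg_sum; apply: ler_sum_ord => i.
have kQ0 : 0 < k%:R * Q by rewrite mulr_gt0 ?ltr0n.
apply: (hoelder_avg (w := W) (y := W)
  (x := fun z => v (k * b) (lift_pt p a xi (tau i) (t i)) z ^+ (2 * k))) => //.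
- by move=> z; rewrite exprn_ge0 ?class_sum_ge0.
- rewrite prednK //; apply: le_trans (hI (lift_pt p a xi (tau i) (t i))).
  by apply: ler_avg => z; rewrite -exprM [(2 * k * k)%N]mulnC.
rewrite prednK //.
apply: (@le_trans _ _ (avg (fun z => \sum_(l < k)
    v b.+1 (eta + p ^ b * tau' l) z ^+ (2 * S)))).
  apply: ler_avg => z; rewrite -exprS WX.
  apply: le_trans (prod_le_sum_expr k0 _) _ => [l|]; first by rewrite exprn_ge0 ?class_sum_ge0.
  by apply: ler_sum => l _; rewrite -exprM -mulnA [(k.+1 * k)%N]mulnC.
(* Enlarging k to k^k avoids taking a k-th root of k. *)
rewrite avg_sum exprMn; apply: (@le_trans _ _ (k%:R * Q ^+ k)).
  apply: ler_sum_ord => l; apply: le_trans hJ; apply: avg_class_sum => //.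
  by apply: leq_trans kbB; rewrite -[ltnLHS]mul1n ltn_pmul2r.
rewrite ler_wpM2r ?exprn_ge0 ?(ltW Q0) // -natrX ler_nat.
by rewrite -[leqLHS]expn1 leq_pexp2l.
Qed.

End EfficientCongruencing.

(** * Iteration over the scales *)

Section ScaleInduction.
Variables (R : realType) (k p : nat) (eta : R).
Hypotheses (k1 : (1 < k)%N) (pp : prime p).
Hypothesis (kp : (2 * k ^ (k * (2 * k.+1)) <= p)%N).
Hypotheses (eta0 : 0 < eta) (eta1 : eta <= 1).

Local Notation S := (k * k.+1)%N.
Local Notation J n := ((vino_count S k (p ^ n))%:R : R).
Local Notation kR := (k%:R : R).
Local Notation q := (powR (p%:R : R)).

(** For S = k(k+1) the conjectural exponent 2S - S/2 is 3k(k+1)/2. *)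
Let theta : R := 3 / 2 * kR * (kR + 1) + eta.
(** A congruencing step replaces the loss C by C/k plus 4k^2 + k + 1 at most; this C is large enough
    to absorb that. *)
Let C : R := 8 * kR ^+ 2 + 2 * kR + 8.
(** The value k^2/2 at n = 0 fits the trivial Hoelder bound. Each iteration gains eta(1-1/k) from
    the factor J_(B-b-1)^(1-1/k). *)
Let beta (n : nat) : R := kR ^+ 2 / 2 - n%:R * eta * (1 - kR^-1).

Let k2 : 2 <= kR. Proof. by rewrite ler_nat. Qed.
Let k0 : (0 < k)%N. Proof. exact: ltnW. Qed.
Let p0 : (0 < p)%N. Proof. exact: prime_gt0. Qed.

Let ltkp : (k < p)%N.
Proof.
apply: leq_trans kp; apply: (@leq_trans (2 * k)); first by clear -k1; lia.
rewrite leq_pmul2l // -[leqLHS]expn1 leq_pexp2l // muln_gt0 k0.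
by rewrite muln_gt0.
Qed.

Let kV : 0 <= kR^-1 <= 2^-1 /\ kR * kR^-1 = 1.
Proof.
have k0R : 0 < kR by rewrite ltr0n.
split; last by rewrite divff // gt_eqF.
by rewrite invr_ge0 ler0n lef_pV2 ?posrE.
Qed.

Let p4 : 4 <= p%:R :> R.
Proof.
rewrite ler_nat; apply: leq_trans kp; rewrite (@leq_mul 2 2) //.
apply: leq_trans (k1) _; rewrite -[leqLHS]expn1 leq_pexp2l // muln_gt0 k0.
by rewrite muln_gt0.
Qed.

Let p1 : 1 <= p%:R :> R. Proof. by move: p4; lra. Qed.

Let qD x y : q (x + y) = q x * q y.
Proof. by rewrite powRD // pnatr_eq0 -lt0n p0 implybT. Qed.

Let q_gt0 x : 0 < q x. Proof. by rewrite powR_gt0 // ltr0n. Qed.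

Let ler_q x y : x <= y -> q x <= q y. Proof. exact: ler_powR. Qed.

Let qX x n : q x ^+ n = q (n%:R * x).
Proof. by rewrite mulrC powRrM powR_mulrn // ltW. Qed.

Let q_nat n : p%:R ^+ n = q n%:R.
Proof. by rewrite powR_mulrn // ler0n. Qed.

Let q1 : q 1 = p%:R. Proof. by rewrite powRr1 ?ler0n. Qed.

Let k_le_q1 : kR <= q 1.
Proof. by rewrite q1 ler_nat ltnW. Qed.

(** A large p turns the power of k lost in [broad_narrow] into a factor of at most p/2. *)
Let kX_le_p : 2 * kR ^+ (k * (2 * k.+1)) <= p%:R.
Proof. by rewrite -natrX -natrM ler_nat. Qed.

Let q_half x : q (x - 1) <= 4^-1 * q x.
Proof.
by rewrite qD powRN q1 mulrC ler_wpM2r ?(ltW (q_gt0 _)) // lef_pV2 ?posrE ?ltr0n.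
Qed.

Let theta_ge0 : 0 <= theta.
Proof. by rewrite /theta !addr_ge0 ?mulr_ge0 ?addr_ge0 ?ler0n ?(ltW eta0). Qed.

Let beta_le n : beta n <= kR ^+ 2 / 2.
Proof.
have [[kV0 kV1] _] := (andP kV.1, kV.2).
by rewrite gerDl oppr_le0 !mulr_ge0 ?ler0n ?ltW //; lra.
Qed.

Section FixedScale.
Variables (B : nat) (alpha : R).
Hypothesis IH : forall B', (B' < B)%N -> J B' <= q (alpha + B'%:R * theta).

Let y := alpha + B%:R * theta.

(* The expected size of a mixed mean, up to the bounded loss C; the factor
   beta n measures what n iterations have not yet gained. *)
Definition mean_exponent (n a b : nat) : R :=
  y - 2 * kR ^+ 2 * b%:R - (2 * kR - kR * (kR + 1) / 2) * a%:R + C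
  + beta n * b%:R.
Local Notation E := mean_exponent.

(** One iteration may double b by narrow steps and then multiply it by k, so it consumes a factor 2k
    of the room below B. *)
Definition improved_bound (n : nat) : Prop := forall a b xi eta' tau,
  (a <= b)%N -> (0 < b)%N -> ((2 * k) ^ n * b.+1 <= B)%N -> injective tau ->
  @mixed_mean R k p B a b xi tau eta' <= q (E n a b).

Let IHB b : (0 < b <= B)%N -> J (B - b)%N <= q (y - b%:R * theta).
Proof.
move=> /andP[b0 bB]; apply: le_trans (IH _) _; first by clear -b0 bB; lia.
by rewrite natrB // mulrBl addrA.
Qed.

(** [mixed_mean_trivial] with the inductive bounds at B-a-1 and B-b. As theta/(k+1) >= 3k/2, the
    coefficient of b is at most -3k^2/2 = -2k^2 + beta 0. *)
Lemma improved_bound0 : improved_bound 0.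
Proof.
move=> a b xi eta' tau ab b0; rewrite expn0 mul1n => bB tauI.
have k1R : 0 < kR + 1 by move: k2; lra.
have kk : k.+1%:R = kR + 1 by rewrite natr1.
apply: (@le_trans _ _ (kR * (q ((y - a.+1%:R * theta) / (kR + 1)) *
                             q ((y - b%:R * theta) / (kR + 1)) ^+ k))).
  have aB : (a < B)%N by apply: leq_trans bB; rewrite ltnS.
  apply: mixed_mean_trivial => //; first exact: ltnW.
    rewrite qX kk mulrC divfK ?gt_eqF //; exact: IHB.
  rewrite qX kk mulrC divfK ?gt_eqF //; by apply: IHB; rewrite b0 ltnW.
rewrite qX -qD; set e1 := (_ / _ + _).
apply: (@le_trans _ _ (q 1 * q e1)); first by rewrite ler_wpM2r ?(ltW (q_gt0 _)).
rewrite -qD ler_q // /E /beta mul0r mul0r subr0.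
have -> : 1 + ((y - a.+1%:R * theta) / (kR + 1) +
               kR * ((y - b%:R * theta) / (kR + 1))) =
          1 + y - (a.+1%:R + kR * b%:R) * (theta / (kR + 1)).
  by field; rewrite gt_eqF.
have t : 3 / 2 * kR <= theta / (kR + 1).
  by rewrite ler_pdivlMr // /theta; move: eta0; lra.
have a0 : 0 <= a%:R :> R by rewrite ler0n.
have b0R : 0 <= b%:R :> R by rewrite ler0n.
have : (a.+1%:R + kR * b%:R) * (3 / 2 * kR) <=
       (a.+1%:R + kR * b%:R) * (theta / (kR + 1)).
  by rewrite ler_wpM2l // addr_ge0 ?mulr_ge0 ?ler0n.
rewrite -natr1 /C; move: (theta / _) => th H.
have : 0 <= kR ^+ 2 * a%:R by rewrite mulr_ge0 ?exprn_ge0 ?ler0n.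
have : 0 <= kR ^+ 2 by rewrite exprn_ge0 ?ler0n.
move: k2 H; lra.
Qed.

(** One congruencing step from scales (a,b) to (b,kb), with the powers of p lost in the broad case
    included. *)
Lemma conditioned_improved n a b xi eta' tau tau' :
  improved_bound n -> (a <= b)%N -> (0 < b)%N ->
  ((2 * k) ^ n * (k * b).+1 <= B)%N -> injective tau -> injective tau' ->
  p%:R ^+ (2 * (k * (2 * k))) *
    (p%:R ^+ k * @conditioned_mean R k p B a b xi tau eta' tau') <=
  4^-1 * q (E n.+1 a b).
Proof.
move=> claim ab b0 kbB tauI tau'I.
have kn : (0 < (2 * k) ^ n)%N by rewrite expn_gt0 muln_gt0 k0.
have kbB' : ((k * b).+1 <= B)%N by apply: leq_trans kbB; rewrite leq_pmull.
have bkb : (b < k * b)%N by rewrite -[ltnLHS]mul1n ltn_pmul2r.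
have akb : (a.+1 <= k * b)%N by apply: leq_ltn_trans bkb.
have k0R : 0 < kR by rewrite ltr0n.
have hI xi' : @mixed_mean R k p B b (k * b) eta' tau' xi' <=
    q (E n b (k * b) / kR) ^+ k.
  rewrite qX mulrC divfK ?gt_eqF //; apply: claim => //; first exact: ltnW.
  by rewrite muln_gt0 k0.
have hJ : J (B - b.+1)%N <= q ((y - b.+1%:R * theta) / kR) ^+ k.
  rewrite qX mulrC divfK ?gt_eqF //; apply: IHB => /=.
  by apply: leq_trans bkb _; apply: ltnW.
have := @conditioned_mean_le R k p B a b xi eta' tau tau' pp ltkp k1 ab b0
  (ltnW kbB') tauI _ _ (q_gt0 _) (q_gt0 _) hI hJ.
set Z := E n b (k * b) / kR; set Q := (y - _) / kR => H.
have {}H : @conditioned_mean R k p B a b xi tau eta' tau' <=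
    q (('C(k, 2) * (a + b))%:R + (((k * b - a.+1) * k)%:R +
      (1 + (Z + (kR - 1) * (1 + Q))))).
  apply: le_trans H _; rewrite !natrX !q_nat !qD.
  rewrite !(ler_wpM2l (ltW (q_gt0 _))) //.
  apply: (@le_trans _ _ (q 1 * (q Z * (kR * q Q) ^+ k.-1))).
    by rewrite ler_wpM2r ?k_le_q1 // mulr_ge0 ?(ltW (q_gt0 _)) // exprn_ge0.
  rewrite !(ler_wpM2l (ltW (q_gt0 _))) //.
  have -> : kR - 1 = k.-1%:R by rewrite -subn1 natrB.
  rewrite -qX qD; apply: lerXn2r; rewrite ?nnegrE ?mulr_ge0 ?ler0n ?(ltW (q_gt0 _)) //.
  by rewrite ler_wpM2r ?(ltW (q_gt0 _)).
apply: le_trans (q_half _).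
rewrite !q_nat mulrA -qD.
apply: le_trans (ler_wpM2l (ltW (q_gt0 _)) H) _; rewrite -qD; apply: ler_q.
have bin : 'C(k, 2)%:R = kR * (kR - 1) / 2 :> R.
  have := mul_bin_diag k 1; rewrite bin1 => /(congr1 (fun m => m%:R : R)).
  by rewrite !natrM -subn1 natrB // => ->; rewrite mulrC mulKf ?pnatr_eq0.
have [/andP[kV0 kV1] kkV] := kV.
(* The last parenthesis is the whole slack; the choice of [C] makes it nonnegative. *)
have -> : E n.+1 a b - 1 = (2 * (k * (2 * k)))%:R + k%:R +
    (('C(k, 2) * (a + b))%:R + (((k * b - a.+1) * k)%:R +
      (1 + (Z + (kR - 1) * (1 + Q))))) +
    (C - 1 - 4 * kR ^+ 2 - kR - C / kR + (1 - kR^-1) * theta).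
  rewrite /Z /Q /E /beta !natrM natrD bin natrB // -!natr1 natrM /theta.
  by field; rewrite gt_eqF.
rewrite lerDl.
have th0 : 0 <= (1 - kR^-1) * theta.
  by apply: mulr_ge0 => //; lra.
have C0 : 0 <= C by rewrite /C; have := sqr_ge0 kR; move: k2; lra.
have : C / kR <= C / 2 by rewrite ler_wpM2l.
by move: th0; rewrite /C; lra.
Qed.

(** Narrow steps raise b by one at a cost of at most p^2/2 each, less than the drop in expected
    size. After b of them in a row this drop alone exceeds the gain demanded at level n+1. *)
Lemma improved_boundS n : improved_bound n -> improved_bound n.+1.
Proof.
move=> claim a b xi eta' tau ab b0 bB tauI.
pose c : R := kR ^+ (k * (2 * k)) * p%:R.
have c0 : 0 <= c by rewrite mulr_ge0 ?exprn_ge0 ?ler0n.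
have cq : c <= 2^-1 * q 2.
  have -> : q 2 = p%:R * p%:R by rewrite -q_nat expr2.
  rewrite mulrA ler_wpM2r ?ler0n // ler_pdivlMl ?ltr0n //.
  apply: le_trans kX_le_p; rewrite ler_wpM2l // ler_weXn2l //.
    by move: k2; lra.
  by rewrite leq_pmul2l // leq_pmul2l // ltnW.
have [/andP[kV0 kV1] kkV] := kV.
have k4 : 4 <= kR ^+ 2 by rewrite expr2; move: k2; nra.
have etak : 0 <= eta * (1 - kR^-1) <= 1.
  rewrite mulr_ge0 ?(ltW eta0) ?mulr_ile1 ?(ltW eta0) //; lra.
have betaS : beta n.+1 = beta n - eta * (1 - kR^-1).
  by rewrite /beta -(natr1 n) !mulrDl mul1r opprD addrA.
have c_step b' : c * (2^-1 * q (E n.+1 a b'.+1)) <= 4^-1 * q (E n.+1 a b').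
  have -> : E n.+1 a b'.+1 = E n.+1 a b' - 2 * kR ^+ 2 + beta n.+1.
    by rewrite /E -(natr1 b'); ring.
  apply: (@le_trans _ _ (4^-1 * (q 2 * q (E n.+1 a b' - 2 * kR ^+ 2 + beta n.+1)))).
    rewrite mulrA [in leRHS]mulrA ler_wpM2r ?(ltW (q_gt0 _)) //.
    by move: cq; lra.
  rewrite ler_wpM2l ?invr_ge0 ?ler0n // -qD ler_q //.
  by move: (beta_le n.+1) k4; lra.
(* Here h narrow steps remain available. The broad terms are summed like a geometric series, 1/4 +
   1/4 = 1/2, and the last term is the level-n bound at b'+h. *)
have main h b' eta1' : (b <= b')%N -> (b' + h <= 2 * b)%N ->
    @mixed_mean R k p B a b' xi tau eta1' <=
    2^-1 * q (E n.+1 a b') + c ^+ h * q (E n a (b' + h)).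
  elim: h b' eta1' => [|h IHh] b' eta1' bb' b'h.
    rewrite addn0 mul1r -[leLHS]add0r lerD ?mulr_ge0 ?(ltW (q_gt0 _)) //.
    apply: claim => //; [exact: leq_trans bb' | exact: leq_trans bb' |].
    apply: leq_trans bB; rewrite expnSr -mulnA leq_mul2l; apply/orP; right.
    clear -b'h b0 k1; rewrite addn0 in b'h; nia.
  apply: le_trans (@mixed_mean_broad_narrow R k p B a b' xi tau eta1'
    (2^-1 * q (E n.+1 a b'.+1) + c ^+ h * q (E n a (b'.+1 + h)))
    (p%:R ^- (2 * (k * (2 * k))) * p%:R ^- k * (4^-1 * q (E n.+1 a b'))) k0 p0 _ _ _) _.
  - by rewrite !mulr_ge0 ?invr_ge0 ?exprn_ge0 ?ler0n ?(ltW (q_gt0 _)).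
  - move=> eta2; apply: IHh; first exact: leqW.
    by rewrite addSnnS.
  - move=> tau' tau'I.
    have bk' : ((2 * k) ^ n * (k * b').+1 <= B)%N.
      apply: leq_trans bB; rewrite expnSr -mulnA leq_mul2l; apply/orP; right.
      by clear -b'h k1; nia.
    have := conditioned_improved xi eta1' claim (leq_trans ab bb')
      (leq_trans b0 bb') bk' tauI tau'I.
    rewrite mulrA -ler_pdivlMl; last by rewrite mulr_gt0 ?exprn_gt0 ?ltr0n.
    by rewrite invfM.
  have pe m : p%:R ^+ m != 0 :> R by rewrite expf_neq0 // pnatr_eq0 -lt0n.
  have pK u w x : u != 0 -> w != 0 -> u * (w * (u^-1 * w^-1 * x)) = x :> R.
    by move=> u0 w0; field; rewrite u0 w0.
  rewrite mulrA -/c pK // mulrDr addSnnS exprS -[in leRHS]mulrA.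
  by move: (c_step b'); lra.
apply: le_trans (main b b eta' (leqnn _) _) _; first by rewrite mul2n addnn.
apply: (@le_trans _ _ (2^-1 * q (E n.+1 a b) + 2^-1 * q (E n.+1 a b))); last by lra.
rewrite lerD2l.
have cb : c ^+ b <= q (2 * b%:R).
  rewrite mulrC -qX lerXn2r ?nnegrE ?(ltW (q_gt0 _)) //.
  by apply: le_trans cq _; move: (q_gt0 2); lra.
apply: le_trans (ler_wpM2r (ltW (q_gt0 _)) cb) _; rewrite -qD.
apply: le_trans (_ : 4^-1 * q (E n.+1 a b) <= _); last first.
  by move: (q_gt0 (E n.+1 a b)); lra.
apply: le_trans (q_half _); apply: ler_q.
rewrite /E betaS natrD.
have b1 : 1 <= b%:R :> R by rewrite ler1n.
have H1 : 0 <= b%:R * (kR ^+ 2 / 2 - beta n) by rewrite mulr_ge0 ?subr_ge0 ?ler0n.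
have H2 : 0 <= b%:R * (1 - eta * (1 - kR^-1)).
  by rewrite mulr_ge0 ?ler0n //; move: etak; lra.
have H3 : 0 <= b%:R * (kR ^+ 2 - 4) by rewrite mulr_ge0 ?ler0n //; lra.
move: H1 H2 H3; nra.
Qed.

Lemma improved_bound_all n : improved_bound n.
Proof. by elim: n => [|n]; [exact: improved_bound0 | exact: improved_boundS]. Qed.

(** At scales (0,1) a sufficiently negative [beta n] outweighs every fixed power of p. The narrow
    part is covered by J_(B-1) since theta >= 2. *)
Lemma vino_count_step n :
  beta n <= - (2 * kR ^+ 2 + 5 * kR + C + 2) -> ((2 * k) ^ n * 2 <= B)%N ->
  J B <= q y.
Proof.
move=> betan nB.
have B0 : (0 < B)%N.
  by apply: leq_trans nB; rewrite muln_gt0 expn_gt0 muln_gt0 k0.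
apply: le_trans (vino_count_broad_narrow k0 p0 B0 (ltW (q_gt0 _)) _) _.
  by move=> xi tau eta' tauI; apply: (@improved_bound_all n).
have J1 := IHB (b := 1) B0.
apply: (@le_trans _ _ (2^-1 * q (2 + (y - 1 * theta)) +
    q ((2 * (k * (2 * k.+1)))%:R + (k%:R + (1 + E n 0 1))))).
  rewrite lerD //.
    rewrite qD mulrA mulrA; apply: ler_pM => //.
    have -> : q 2 = p%:R * p%:R by rewrite -q_nat expr2.
    by rewrite mulrA ler_wpM2r ?ler0n // ler_pdivlMl ?ltr0n.
  rewrite !q_nat !qD !(ler_wpM2l (ltW (q_gt0 _))) //.
  by rewrite ler_wpM2r ?k_le_q1 ?(ltW (q_gt0 _)).
have -> : q y = 2^-1 * q y + 2^-1 * q y by lra.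
rewrite lerD //.
  rewrite ler_wpM2l ?invr_ge0 ?ler0n // ler_q // /theta.
  have : 0 <= kR * (kR - 2) by rewrite mulr_ge0 ?ler0n // subr_ge0.
  by move: eta0 k2; lra.
apply: (@le_trans _ _ (4^-1 * q y)); last by move: (q_gt0 y); lra.
apply: le_trans (q_half _); apply: ler_q.
rewrite /E !natrM -!(natr1 k) mulr0 subr0 mulr1.
by move: betan; lra.
Qed.

End FixedScale.
(** First n is fixed from k and eta, using 1 - 1/k >= 1/2. Then [alpha] is taken so large that the
    trivial bound covers every B below 2(2k)^n; larger B follow by strong induction. *)
Lemma vino_count_scale_bound :
  exists alpha, forall B, J B <= q (alpha + B%:R * theta).
Proof.
have [/andP[kV0 kV1] kkV] := kV.
pose D : R := kR ^+ 2 / 2 + (2 * kR ^+ 2 + 5 * kR + C + 2).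
have D0 : 0 <= D.
  by rewrite /D /C; have := sqr_ge0 kR; move: k2; lra.
pose n := Num.bound (2 * D / eta).
have betan : beta n <= - (2 * kR ^+ 2 + 5 * kR + C + 2).
  suff : D <= n%:R * eta * (1 - kR^-1) by rewrite /beta /D; lra.
  have : 2 * D / eta < n%:R.
    by apply: archi_boundP; rewrite divr_ge0 ?mulr_ge0 ?(ltW eta0).
  rewrite ltr_pdivrMr // => Dn.
  apply: (@le_trans _ _ (n%:R * eta * 2^-1)); first by lra.
  by rewrite ler_wpM2l ?mulr_ge0 ?ler0n ?(ltW eta0) //; lra.
exists ((2 * S)%:R * ((2 * k) ^ n * 2)%:R).
elim/ltn_ind => B IH; have [nB|Bn] := leqP ((2 * k) ^ n * 2) B.
  exact: (vino_count_step IH betan nB).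
apply: (@le_trans _ _ (q ((2 * S)%:R * B%:R))).
  rewrite -natrM -q_nat -natrX ler_nat [(2 * S * B)%N]mulnC expnM.
  exact: vino_count_le_expn.
apply: ler_q; rewrite -[leLHS]addr0 lerD ?mulr_ge0 ?ler0n //.
by rewrite ler_wpM2l ?ler0n // ler_nat ltnW.
Qed.

End ScaleInduction.

(** * The mean value as a number of solutions *)

Lemma integral01_FTC (R : realType) (f F : R -> R) :
  (forall x, is_derive x (1 : R) F (f x)) -> continuous f ->
  (\int[lebesgue_measure]_(a in `[0%R, 1%R[%classic) (f a)%:E)%E =
  (F 1 - F 0)%:E.
Proof.
move=> dF cf.
have cF : continuous F.
  move=> x; apply/differentiable_continuous/derivable1_diffP.
  by case: (dF x).
rewrite integral_itv_bndo_bndc; last first.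
  apply/measurable_EFinP/measurable_funTS.
  exact: continuous_measurable_fun.
rewrite (@continuous_FTC2 _ f F) //.
- exact: continuous_subspaceT.
- split=> [x _||]; first by case: (dF x).
  + exact/cvg_at_right_filter/cF.
  + exact/cvg_at_left_filter/cF.
- by move=> x _; rewrite derive1E; case: (dF x).
Qed.

Lemma is_derive_affine (R : realType) (c d x : R) :
  is_derive x (1 : R) (fun a => c + a * d) d.
Proof.
have -> : (fun a => c + a * d) = cst c + d \*: (@id R).
  by apply/boolp.funext => a; rewrite /= mulrC.
apply: is_derive_eq; rewrite add0r.
by rewrite [LHS]mulr1.
Qed.

Lemma is_derive_sum_fun (R : realType) (I : finType) (g : I -> R -> R)
    (dg : I -> R) (x : R) :
  (forall i, is_derive x (1 : R) (g i) (dg i)) ->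
  is_derive x (1 : R) (fun a => \sum_i g i a) (\sum_i dg i).
Proof.
move=> H.
have -> : (fun a => \sum_i g i a) = \sum_i g i.
  by apply/boolp.funext => a; rewrite fct_sumE.
by elim/big_ind2 : _ => // [|] *; [exact: is_derive_cst|exact: is_deriveD].
Qed.

(** Terms with [h i] = 0 are constant; the others have a sine as antiderivative, with equal values
    at 0 and 1 by periodicity. *)
Lemma integral01_sum_cos (R : realType) (I : finType) (w c : I -> R)
    (h : I -> int) :
  (\int[lebesgue_measure]_(a in `[0%R, 1%R[%classic)
     (\sum_i w i * cos (2 * pi * (c i + a * (h i)%:~R)))%:E)%E =
  (\sum_i w i * (h i == 0)%:R * cos (2 * pi * c i))%:E.
Proof.
pose g i (a : R) := if h i == 0 then 0 + a * (w i * cos (2 * pi * c i)) else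
  w i * sin (2 * pi * c i + a * (2 * pi * (h i)%:~R)) / (2 * pi * (h i)%:~R).
have E i a : 2 * pi * (c i + a * (h i)%:~R) =
    2 * pi * c i + a * (2 * pi * (h i)%:~R) :> R by ring.
have dG (x : R) : is_derive x (1 : R) (fun a => \sum_i g i a)
    (\sum_i w i * cos (2 * pi * (c i + x * (h i)%:~R))).
  apply: is_derive_sum_fun => i; rewrite E /g.
  case: eqP => [->|/eqP hi].
    by rewrite mulr0 mulr0 addr0; exact: is_derive_affine.
  have hi0 : 2 * pi * (h i)%:~R != 0 :> R.
    by rewrite mulf_neq0 ?intr_eq0 // mulf_neq0 ?pnatr_eq0 // gt_eqF ?pi_gt0.
  have d1 := is_derive1_comp (is_derive_sin _)
    (is_derive_affine (2 * pi * c i) (2 * pi * (h i)%:~R) x).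
  rewrite (_ : (fun a : R => _) = (w i / (2 * pi * (h i)%:~R)) \*:
    (sin \o (fun a => 2 * pi * c i + a * (2 * pi * (h i)%:~R)))); last first.
    by apply/boolp.funext => a /=; rewrite mulrAC.
  apply: is_derive_eq; rewrite -[LHS]/(_ * (_ * _)).
  by move: (2 * pi * (h i)%:~R) hi0 => u u0; field.
have cG : continuous (fun x : R =>
    \sum_i w i * cos (2 * pi * (c i + x * (h i)%:~R))).
  move=> x.
  have cx (i : I) : is_derive x (1 : R)
      (w i \*: (cos \o (fun a => 2 * pi * c i + a * (2 * pi * (h i)%:~R))))
      (w i *: (- sin (2 * pi * c i + x * (2 * pi * (h i)%:~R)) *
        (2 * pi * (h i)%:~R))).
    apply: is_deriveZ; apply: is_derive1_comp; exact: is_derive_affine.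
  have := is_derive_sum_fun cx.
  rewrite (_ : (fun a => _) = (fun a : R =>
    \sum_i w i * cos (2 * pi * (c i + a * (h i)%:~R)))); last first.
    by apply/boolp.funext => a; apply: eq_bigr => i _; rewrite /= E.
  by case=> d _; apply/differentiable_continuous/derivable1_diffP.
rewrite (integral01_FTC dG cG); congr EFin; rewrite -sumrB.
apply: eq_bigr => i _; rewrite /g.
case: eqP => [_|/eqP hi]; first by rewrite mulr1; ring.
rewrite mulr0 mul0r mul0r addr0 mul1r.
suff -> : sin (2 * pi * c i + 2 * pi * (h i)%:~R) = sin (2 * pi * c i) :> R.
  by rewrite subrr.
have per (x : R) n : sin (x + 2 * pi * n%:R) = sin x.
  rewrite (_ : 2 * pi * n%:R = pi *+ 2 *+ n).
    by rewrite (periodicn (@sinD2pi R)).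
  by rewrite -[RHS]mulr_natr -[pi *+ 2]mulr_natl.
case: (h i) => n; first by rewrite -[_%:~R]/(n%:R : R) per.
by rewrite NegzE mulrNz mulrN -[LHS](per _ n.+1) subrK.
Qed.

(** The phases [c i] make the induction work: they absorb the contribution of the outer coordinates,
    already fixed. *)
Lemma unit_cube_integral_sum_cos (R : realType) (I : finType) (k : nat)
    (w c : I -> R) (h : I -> 'I_k -> int) :
  unit_cube_integral (fun t : k.-tuple R =>
    (\sum_i w i *
      cos (2 * pi * (c i + \sum_j tnth t j * (h i j)%:~R)))%:E) =
  (\sum_i w i * [forall j, h i j == 0]%:R * cos (2 * pi * c i))%:E.
Proof.
elim: k w c h => [|k IHk] w c h /=.
  congr EFin; apply: eq_bigr => i _; rewrite big_ord0 addr0.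
  rewrite (_ : [forall j, _] = true) ?mulr1 //; by apply/forallP => -[].
rewrite [LHS](_ : _ = \int[lebesgue_measure]_(a in `[0%R, 1%R[%classic)
  (\sum_i w i * [forall j, h i (lift ord0 j) == 0]%:R *
     cos (2 * pi * (c i + a * (h i ord0)%:~R)))%:E)%E; last first.
  congr integral; apply/boolp.funext => a.
  rewrite -IHk; congr unit_cube_integral; apply/boolp.funext => t.
  congr EFin; apply: eq_bigr => i _; congr (_ * cos (_ * _)).
  rewrite big_ord_recl tnth0 -addrA; congr (_ + (_ + _)).
  by apply: eq_bigr => j _; rewrite tnthS.
rewrite integral01_sum_cos; congr EFin; apply: eq_bigr => i _.
congr (_ * _); rewrite -mulrA -natrM mulnb; congr (_ * _%:R).
congr nat_of_bool; apply/andP/forallP => [[/forallP H h0] j|H].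
  by case: (unliftP ord0 j) => [j'|] ->.
by split=> //; apply/forallP.
Qed.

Lemma Re_e (R : realType) (x : R) : complex.Re (e x) = cos (2 * pi * x).
Proof. by []. Qed.

(** The expanded 2s-th power is a finite sum of cosines, whose integral counts solutions. Only an
    inequality results, since [vino_count] also admits the value 0. *)
Lemma vinogradov_mean_value_le (R : realType) (s k : nat) (X : R) :
  (vinogradov_mean_value s k X <=
    (vino_count s k (Num.truncn X).+1)%:R%:E)%E.
Proof.
set n := (Num.truncn X).+1; pose Q := fun _ : 'I_s => [pred x : 'I_n | (0 < x)%N].
pose fam : pred {ffun 'I_s -> 'I_n} := family Q.
pose h (xy : {ffun 'I_s -> 'I_n} * {ffun 'I_s -> 'I_n}) (j : 'I_k) : int :=
  (psum j.+1 (fun l => xy.1 l : nat))%:Z - (psum j.+1 (fun l => xy.2 l : nat))%:Z.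
rewrite /vinogradov_mean_value.
have -> : (fun alpha : k.-tuple R => (nrm (weyl_sum alpha X) ^+ (2 * s))%:E) =
    (fun alpha : k.-tuple R => (\sum_xy (fam xy.1 && fam xy.2)%:R *
      cos (2 * pi * (0 + \sum_j tnth alpha j * (h xy j)%:~R)))%:E).
  apply/boolp.funext => al; congr EFin.
  have -> : weyl_sum al X = wsum [pred x : 'I_n | (0 < x)%N] (tnth al).
    by rewrite /weyl_sum big_geq_mkord.
  rewrite mulnC exprM -normcX normc_sqr -[s in _ ^+ s]card_ord -prodr_const.
  rewrite (prod_wsum Q) rmorph_sum big_distrlr /= Re_sum.
  rewrite -(pair_bigA _ (fun x y => (fam x && fam y)%:R *
    cos (2 * pi * (0 + \sum_j tnth al j * (h (x, y) j)%:~R)))) /= big_mkcond.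
  apply: eq_bigr => x _; rewrite -/(fam x) unfold_in -/(fam x).
  case: (fam x); last by rewrite big1 // => y _; rewrite mul0r.
  rewrite Re_sum big_mkcond; apply: eq_bigr => y _; rewrite unfold_in -/(fam y).
  case: (fam y); rewrite ?mul0r // mul1r.
  rewrite -[X in complex.Re (_ * X)]/(conjc (e (\sum_j tnth al j *
    (psum j.+1 (fun l => y l : nat))%:R))) -eN -eD Re_e add0r -sumrB.
  congr (cos (_ * _)); apply: eq_bigr => j _.
  by rewrite -mulrBr /h rmorphB.
rewrite unit_cube_integral_sum_cos lee_fin /vino_count /nsol -sum1_card natr_sum.
rewrite [leRHS]big_mkcond; apply: ler_sum => -[x y] _.
rewrite mulr0 cos0 mulr1 inE /=.
have -> : (x \in family (fun _ : 'I_s => @predT 'I_n)) by apply/familyP.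
have -> : (y \in family (fun _ : 'I_s => @predT 'I_n)) by apply/familyP.
rewrite /= -natrM mulnb (_ : [forall j, h (x, y) j == 0] = [forall j : 'I_k,
    psum j.+1 (fun l => x l : nat) == psum j.+1 (fun l => y l : nat)]).
  by case: [forall _, _]; case: (fam x && fam y).
by apply: eq_forallb => j; rewrite subr_eq0 eqz_nat.
Qed.

(** * Reduction of general s and X to s = k(k+1) and prime powers *)

Lemma normc_wsum_le (R : realType) (k n : nat) (q : pred 'I_n)
    (alpha : 'I_k -> R) : nrm (wsum q alpha) <= n%:R.
Proof.
rewrite /wsum big_mkcond; apply: le_trans (normc_sum _) _.
rewrite -[n%:R]mulr1; apply: ler_sum_ord => x; case: ifP => _; last first.
  by rewrite ComplexField.Normc.normc0.
by rewrite /e /= cos2Dsin2 sqrtr1.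
Qed.

(** The additional 2(s-S) factors are bounded trivially by n; the grid chosen for s is fine enough
    for S as well. *)
Lemma vino_count_extend (R : realType) (s S k n : nat) : (S <= s)%N ->
  (vino_count s k n <= n ^ (2 * (s - S)) * vino_count S k n)%N.
Proof.
move=> Ss; pose M := (s * n ^ k).+1.
have LM : (#|'I_s| * n ^ k < M)%N by rewrite card_ord.
have LM' : (#|'I_S| * n ^ k < M)%N by rewrite card_ord ltnS leq_mul.
rewrite -(ler_nat R) natrM /vino_count -(avg_prod_normc R LM).
rewrite -(avg_prod_normc R LM') -avgZ; apply: ler_avg => z.
rewrite !prodr_const !card_ord -!exprM -{1}(subnK Ss) mulnDr exprD.
by rewrite ler_wpM2r ?exprn_ge0 ?normc_ge0 // natrX lerXn2r ?nnegrE ?normc_ge0 //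
  normc_wsum_le.
Qed.

Theorem theorem1p1 (R : realType) (s k : nat)
    (hk : (2 <= k)%N) (hs : (k * (k + 1) <= s)%N)
    (eps : R) (heps : 0 < eps) :
  exists2 C : R, 0 < C &
    forall X : R, 1 <= X ->
      (vinogradov_mean_value s k X <=
        (C * X `^ ((2 * s)%:R - 2^-1 * (k * (k + 1))%:R + eps))%:E)%E.
Proof.
pose eta := Num.min eps 1.
have eta0 : 0 < eta by rewrite lt_min heps ltr01.
have eta1 : eta <= 1 by rewrite ge_min lexx orbT.
have eta_eps : eta <= eps by rewrite ge_min lexx.
have [p pk pp] := prime_above (2 * k ^ (k * (2 * k.+1))).
have [alpha Ha] := vino_count_scale_bound hk pp (ltnW pk) eta0 eta1.
rewrite addn1 in hs *; set S := (k * k.+1)%N in hs Ha *.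
have p0 := prime_gt0 pp; have p0R : 0 < p%:R :> R by rewrite ltr0n.
(* With S = k(k+1), this is 2s - k(k+1)/2 + eta. *)
pose D : R := (2 * (s - S))%:R + (3 / 2 * k%:R * (k%:R + 1) + eta).
have D0 : 0 <= D by rewrite !addr_ge0 ?mulr_ge0 ?addr_ge0 ?ler0n ?(ltW eta0).
exists (p%:R `^ alpha * p%:R `^ D); first by rewrite mulr_gt0 ?powR_gt0.
move=> X X1; set m := Num.truncn X.
have X0 : 0 < X by apply: lt_le_trans X1.
have m1 : (0 < m)%N by rewrite truncn_gt0.
have mX : m%:R <= X by rewrite truncn_le // ltW.
(* The least power of p exceeding X is at most pX, which costs only the factor p^D in the
   constant. *)
pose B := (trunc_log p m).+1.
have p1 := prime_gt1 pp.
have mB : (m < p ^ B)%N by rewrite trunc_log_ltn.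
have BX : (p ^ B)%:R <= p%:R * X.
  rewrite /B expnS natrM ler_wpM2l ?ler0n // (le_trans _ mX) // ler_nat.
  by rewrite trunc_logP.
apply: le_trans (vinogradov_mean_value_le _ _ _) _; rewrite lee_fin -/m.
apply: (@le_trans _ _ ((p ^ B)%:R ^+ (2 * (s - S)) *
    p%:R `^ (alpha + B%:R * (3 / 2 * k%:R * (k%:R + 1) + eta)))).
  apply: (@le_trans _ _ (((p ^ B) ^ (2 * (s - S)) * vino_count S k (p ^ B))%N%:R)).
    rewrite ler_nat (leq_trans (leq_vino_count _ _ mB)) //.
    exact: (vino_count_extend R).
  by rewrite natrM natrX ler_wpM2l ?exprn_ge0 ?ler0n.
have -> : (p ^ B)%:R ^+ (2 * (s - S)) *
    p%:R `^ (alpha + B%:R * (3 / 2 * k%:R * (k%:R + 1) + eta)) =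
    p%:R `^ alpha * (p ^ B)%:R `^ D.
  rewrite powRD ?pnatr_eq0 -?lt0n ?p0 ?implybT // mulrCA; congr (_ * _).
  rewrite [in RHS]powRD ?pnatr_eq0 -?lt0n ?expn_gt0 ?p0 ?implybT //.
  by rewrite powR_mulrn ?ler0n // powRrM natrX powR_mulrn ?ler0n.
rewrite -mulrA ler_wpM2l ?powR_ge0 //.
apply: (@le_trans _ _ ((p%:R * X) `^ D)).
  by rewrite ge0_ler_powR // nnegrE ?mulr_ge0 ?ler0n ?(ltW X0).
rewrite powRM ?ler0n ?(ltW X0) // ler_wpM2l ?powR_ge0 //.
apply: ler_powR => //; rewrite /D mulnBr natrB ?leq_mul2l //.
rewrite /S !natrM -(natr1 k); move: eta_eps; lra.
Qed.
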